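(* (i) For every $\tau\in\{0,1\}^{\mathbb N}$, every bi-infinite smooth sequence $x\in X_\tau$ and every finite word $w\in\{1,3\}^*$, the frequency $\mathrm{freq}_x(w)=\lim_{n\to\infty}\frac1n|x_0\cdots x_{n-1}|_w$ exists and equals $\mu_\tau([w])$, where $\mu_\tau$ is the unique $S$-invariant Borel probability measure on $X_\tau$; in particular it depends only on $w$ and on the type sequence $\tau$ of $x$. (ii) For every one-sided smooth sequence $x\in\{1,3\}^{\mathbb N}$ and every finite word $w\in\{1,3\}^*$, the frequency $\mathrm{freq}_x(w)=\lim_{n\to\infty}\frac1n|x_0\cdots x_{n-1}|_w$ exists.
   Context: Conventions: $\mathbb N=\{0,1,2,\dots\}$; $S$ is the shift, $(Sx)_n=x_{n+1}$; $|x_0\cdots x_{n-1}|_w$ is the number of occurrences of $w$ as a factor (contiguous subword) of $x_0\cdots x_{n-1}$; $[w]=\{x: x_0\cdots x_{|w|-1}=w\}$. One-sided smooth sequences. For a sequence $x\in\{1,3\}^{\mathbb N}$ that is not eventually constant, $\Delta x$ is the sequence of the lengths of its consecutive maximal runs of equal symbols (starting with the run beginning at position $0$); $x$ is smooth if $\Delta^k x$ is well-defined and in $\{1,3\}^{\mathbb N}$ for all $k\ge0$. Bi-infinite smooth sequences. A mono-symbol block of $x\in\{1,3\}^{\mathbb Z}$ is a maximal run of equal consecutive symbols. If all mono-symbol blocks of $x$ are finite, $\Delta x$ is the bi-infinite sequence of lengths of the consecutive mono-symbol blocks of $x$, indexed so that $(\Delta x)_0$ is the length of the block containing position $0$. $x$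 is smooth if $\Delta^k x$ is well-defined and in $\{1,3\}^{\mathbb Z}$ for all $k\ge0$. $X$ is the set of bi-infinite smooth sequences. Recoding. Let $\mathcal A=\{\mathtt A,\mathtt B,\mathtt C,\mathtt D\}$ encode the blocks $\mathtt A=1$, $\mathtt B=3$, $\mathtt C=111$, $\mathtt D=333$. For $x\in X$, $\mathrm{rec}(x)\in\mathcal A^{\mathbb Z}$ is the sequence of codes of the consecutive mono-symbol blocks of $x$, with $\mathrm{rec}(x)_0$ the code of the block containing $x_0$. Each letter of $y=\mathrm{rec}(x)$ corresponds to one letter of $\Delta x$. The factor of $y$ corresponding to a mono-symbol block of $\Delta x$ is called an elementary block of $y$: the block $1$ gives $\mathtt A$ or $\mathtt B$; $3$ gives $\mathtt C$ or $\mathtt D$; $111$ gives $\mathtt{ABA}$ or $\mathtt{BAB}$; $333$ gives $\mathtt{CDC}$ or $\mathtt{DCD}$. Types. $x\in X$ has type $0$ if $\mathrm{rec}(x)$ contains an elementary block in $\{\mathtt{ABA},\mathtt{DCD}\}$, and type $1$ if it contains an elementary block in $\{\mathtt{BAB},\mathtt{CDC}\}$; every $x\in X$ has exactly one type. $\mathrm{Types}(x)=(\mathrm{type}(\Delta^n x))_{n\in\mathbb N}$, and $X_\tau=\{x\in X:\mathrm{Types}(x)=\tau\}$, which is a nonempty, closed, shift-invariant set carrying a unique $S$-invariant Borel probability measure $\mu_\tau$. *)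

(* Defs.v *)
From mathcomp Require Import all_boot all_order all_algebra.
From mathcomp Require Import all_classical all_reals all_analysis.
Set Implicit Arguments.
Unset Strict Implicit.
Unset Printing Implicit Defensive.
Import Order.TTheory GRing.Theory Num.Theory numFieldNormedType.Exports.

Local Open Scope classical_set_scope.
Local Open Scope ring_scope.

(* Sequences over {1,3} are represented by nat-valued sequences all of whose
   terms lie in {1,3}, so that a sequence of run lengths has the same type as
   the sequence it is computed from. *)
Definition letter (a : nat) : bool := a \in [:: 1; 3]%N.

(** One-sided sequences *)

Definition eventually_constant (x : nat -> nat) : Prop :=
  exists N, forall n, (N <= n)%N -> x n = x N.

(* [s k] is the first position of the [k]-th maximal run. *)
Definition is_run_starts (x : nat -> nat) (s : nat -> nat) : Prop :=
  [/\ s 0%N = 0%N,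
      forall k, (s k < s k.+1)%N,
      forall k i, (s k <= i < s k.+1)%N -> x i = x (s k)
    & forall k, x (s k.+1) <> x (s k)].

(* Such an [s] exists, and is unique, exactly when [x] is not eventually
   constant; the default value is irrelevant otherwise. *)
Definition run_starts (x : nat -> nat) : nat -> nat :=
  xget (fun=> 0%N) (is_run_starts x).

Definition delta (x : nat -> nat) : nat -> nat :=
  fun k => (run_starts x k.+1 - run_starts x k)%N.

Definition smooth (x : nat -> nat) : Prop :=
  forall k, (forall n, letter (iter k delta x n))
            /\ ~ eventually_constant (iter k delta x).

(** Bi-infinite sequences *)

Definition finite_blocks (x : int -> nat) : Prop :=
  forall i, (exists2 j, i < j & x j <> x i) /\ (exists2 j, j < i & x j <> x i).

(* [s k] is the first position of the [k]-th mono-symbol block, block 0 being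
   the one that contains position 0. *)
Definition is_block_starts (x : int -> nat) (s : int -> int) : Prop :=
  [/\ s 0 <= 0 < s 1,
      forall k, s k < s (k + 1),
      forall k i, s k <= i < s (k + 1) -> x i = x (s k)
    & forall k, x (s (k + 1)) <> x (s k)].

(* Such an [s] exists, and is unique, exactly when [finite_blocks x]. *)
Definition block_starts (x : int -> nat) : int -> int :=
  xget (fun=> 0) (is_block_starts x).

Definition Delta (x : int -> nat) : int -> nat :=
  fun k => `|block_starts x (k + 1) - block_starts x k|%N.

Definition bismooth (x : int -> nat) : Prop :=
  forall k, (forall i, letter (iter k Delta x i))
            /\ finite_blocks (iter k Delta x).

(** Recoding and types *)

Inductive code : Set := cA | cB | cC | cD.

(* The code of the block a^l: A = 1, B = 3, C = 111, D = 333.  Only the values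
   at a, l in {1,3} matter. *)
Definition block_code (a l : nat) : code :=
  if l == 1%N then (if a == 1%N then cA else cB)
  else (if a == 1%N then cC else cD).

Definition recode (x : int -> nat) : int -> code :=
  fun k => block_code (x (block_starts x k)) (Delta x k).

(* The factor of [recode x] sitting over the [k]-th mono-symbol block of
   [Delta x]. *)
Definition elementary_block (x : int -> nat) (k : int) : seq code :=
  mkseq (fun i => recode x (block_starts (Delta x) k + i%:Z))
        (Delta (Delta x) k).

(* Types 0 and 1 are [false] and [true]. *)
Definition has_type (x : int -> nat) (b : bool) : Prop :=
  exists k : int,
    if b then elementary_block x k = [:: cB; cA; cB]
              \/ elementary_block x k = [:: cC; cD; cC]
    else elementary_block x k = [:: cA; cB; cA]
         \/ elementary_block x k = [:: cD; cC; cD].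

Definition Xtype (tau : nat -> bool) : set (int -> nat) :=
  [set x | bismooth x /\ forall n, has_type (iter n Delta x) (tau n)].

(** Shift-invariant Borel probability measures *)

(* Borel sigma-algebra of the product topology, nat being discrete. *)
Definition biseq := g_sigma_algebraType (@open {ptws int -> nat}).

Definition shift (x : int -> nat) : int -> nat := fun i => x (i + 1).

(* A Borel probability measure on the closed set [Y] is a Borel probability
   measure on the ambient space that gives [Y] full mass. *)
Definition invariant_probability_on (R : realType) (Y : set (int -> nat))
    (mu : probability biseq R) : Prop :=
  mu Y = 1%E /\
  forall A : set biseq, measurable A -> mu (shift @^-1` A) = mu A.

(** Words and frequencies *)

Definition word (w : seq nat) : bool := all letter w.

(* The number of occurrences of [w] as a factor of [u], overlaps included. *)
Definition occurrences (w u : seq nat) : nat :=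
  count (fun i => prefix w (drop i u)) (iota 0 (size u).+1).

Definition has_freq (R : realType) (x : nat -> nat) (w : seq nat) (l : R)
    : Prop :=
  (occurrences w (mkseq x n))%:R / n%:R @[n --> \oo] --> l.

Definition right_half (x : int -> nat) : nat -> nat := fun n => x n%:Z.

Definition cylinder (w : seq nat) : set (int -> nat) :=
  [set x | mkseq (right_half x) (size w) = w].

(* Main.v *)
From HB Require Import structures.
Require Import Defs.
From mathcomp Require Import all_boot all_order all_algebra.
From mathcomp Require Import all_classical all_reals all_analysis.
From mathcomp Require Import measurable_realfun.
From mathcomp Require Import zify lra ring.
Set Implicit Arguments.
Unset Strict Implicit.
Unset Printing Implicit Defensive.
Import Order.TTheory GRing.Theory Num.Theory numFieldNormedType.Exports.

(* If x has type t, then [recode x] is the image of [recode (Delta x)] under a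
   substitution [sigma t], so the sequences of [Xtype tau] are those all of whose
   factors occur, for every n, in sigma_(tau 0) ... sigma_(tau (n-1)) (u) with u
   a word whose letters alternately code blocks of 1s and of 3s.

   In such a word of even length 2h with c letters C and d letters D, the ratios
   p = c / h and q = d / h determine all letter frequencies, and applying sigma
   turns {p, q} into {q / (1+p+q), (1+q) / (1+p+q)}.  In the sup norm this map is
   Lipschitz with constant 1 / (1+p+q), which is at most 2/3 after one step, so
   the letter frequencies converge uniformly at every level.  The mean length of
   the images of letters grows like (3/2)^n, so few occurrences of a word w
   straddle two images, and the frequency of w converges uniformly too.

   The limits form a consistent family, which the pushforward of Lebesgue measure
   on [0, 1[ under a nested interval coding realizes as an invariant probability.
   Uniform convergence forces any invariant probability on [Xtype tau] to give
   each cylinder its frequency, hence uniqueness. *)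

(** The sequence [tau] is arbitrary, so no single matrix is iterated and the usual Perron-Frobenius
    argument does not apply. Nor does every letter expand: [sigma false] fixes [cA], so under
    constant type 0 the image of that letter never grows. Lengths and counts are therefore estimated
    on words with as many blocks of 1s as of 3s, a property that the substitutions preserve. One
    substitution gives p + q >= 1/2, because p <= 1; the resulting bound 1 + p + q >= 3/2 yields
    both the contraction ratio 2/3 and the growth rate 3/2.

    Frequencies of words need two depths. The outer n levels make the seams between images rare; m
    further levels make the letter ratios seen at level n almost independent of the word. The
    Lipschitz constant linking the two depends on n, so n is fixed before m.

    The description of [Xtype tau] by factors serves in both directions: from smoothness to factors
    for the frequencies, and back so that a measure vanishing on the cylinders of all inadmissible
    words gives [Xtype tau] full mass. *)

Local Notation code := Defs.code.

(** * The substitutions *)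

Definition len (c : code) : nat := match c with cA | cB => 1 | _ => 3 end.

Definition col (c : code) : nat := match c with cA | cC => 1 | _ => 3 end.

Definition alternating (v : seq code) : bool :=
  sorted (fun a b => col a != col b) v.

(* The elementary block of a type [t] sequence [x] that codes, in [recode x],
   the letter [c] of [recode (Delta x)]. *)
Definition sigma (t : bool) (c : code) : seq code :=
  match t, c with
  | false, cA => [:: cA] | false, cB => [:: cD]
  | false, cC => [:: cA; cB; cA] | false, cD => [:: cD; cC; cD]
  | true, cA => [:: cB] | true, cB => [:: cC]
  | true, cC => [:: cB; cA; cB] | true, cD => [:: cC; cD; cC]
  end.

Definition subst (t : bool) (v : seq code) : seq code := flatten (map (sigma t) v).

Definition phi (v : seq code) : seq nat :=
  flatten [seq nseq (len c) (col c) | c <- v].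

Fixpoint substs (tau : nat -> bool) (n : nat) (v : seq code) : seq code :=
  if n is m.+1 then subst (tau 0) (substs (tau \o succn) m v) else v.

Definition lang (tau : nat -> bool) (n : nat) (W : seq nat) : Prop :=
  exists2 u, alternating u & infix W (phi (substs tau n u)).

Lemma letterP a : letter a -> a = 1 \/ a = 3.
Proof. by rewrite /letter !inE => /orP[] /eqP->; [left|right]. Qed.

Lemma letter_col c : letter (col c). Proof. by case: c. Qed.

Lemma len_gt0 c : 0 < len c. Proof. by case: c. Qed.

Lemma block_codeK c : block_code (col c) (len c) = c. Proof. by case: c. Qed.

Lemma col_block_code a l : letter a -> letter l -> col (block_code a l) = a.
Proof. by move=> /letterP[]-> /letterP[]->. Qed.

Lemma len_block_code a l : letter a -> letter l -> len (block_code a l) = l.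
Proof. by move=> /letterP[]-> /letterP[]->. Qed.

Lemma subst_cat t u v : subst t (u ++ v) = subst t u ++ subst t v.
Proof. by rewrite /subst map_cat flatten_cat. Qed.

Lemma subst_cons t c v : subst t (c :: v) = sigma t c ++ subst t v.
Proof. by []. Qed.

Lemma phi_cat u v : phi (u ++ v) = phi u ++ phi v.
Proof. by rewrite /phi map_cat flatten_cat. Qed.

Lemma phi_cons c v : phi (c :: v) = nseq (len c) (col c) ++ phi v.
Proof. by []. Qed.

Lemma substs_cat tau n u v : substs tau n (u ++ v) = substs tau n u ++ substs tau n v.
Proof. by elim: n tau => //= n IH tau; rewrite IH subst_cat. Qed.

Lemma substs_nil tau n : substs tau n [::] = [::].
Proof. by elim: n tau => //= n IH tau; rewrite IH. Qed.

Lemma substsD tau m n v :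
  substs tau (m + n) v = substs tau m (substs (fun k => tau (m + k)) n v).
Proof.
elim: m tau => [|m IH] tau //=.
by rewrite IH.
Qed.

(* The lengths of the blocks coded by [recode x] are the letters of [Delta x]. *)
Lemma map_len_subst t v : map len (subst t v) = phi v.
Proof.
elim: v => // c v IH; rewrite subst_cons map_cat IH phi_cons.
by move: {IH} t c => [] [].
Qed.

Lemma all_letter_phi v : all letter (phi v).
Proof.
elim: v => // c v IH; rewrite phi_cons all_cat IH andbT.
by apply/allP => a /nseqP[-> _]; apply: letter_col.
Qed.

(* The only pairs of letters allowed in a sequence of type [t]. *)
Definition type_rel (t : bool) (a b : code) : bool :=
  (col a != col b) && ((len a != len b) ==> ((col b != len b) == t)).

Lemma subst_sorted t v : alternating v -> sorted (type_rel t) (subst t v).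
Proof.
elim: v => // c [|d v] IH.
  by move=> _; rewrite /subst /= cats0; move: {IH} t c => [] [].
rewrite /alternating /= => /andP[cd /IH]; rewrite !subst_cons.
by clear IH; move: t c d cd => [] [] [].
Qed.

Lemma sub_sorted_type_rel t v : sorted (type_rel t) v -> alternating v.
Proof. by apply: sub_sorted => a b /andP[]. Qed.

Lemma subst_alternating t v : alternating v -> alternating (subst t v).
Proof. by move=> /(subst_sorted t)/sub_sorted_type_rel. Qed.

Lemma substs_alternating tau n v : alternating v -> alternating (substs tau n v).
Proof. by move=> av; elim: n tau => //= n IH tau; exact: subst_alternating. Qed.

Lemma alternating_cat u v : alternating (u ++ v) -> alternating u /\ alternating v.
Proof.
rewrite /alternating; case: u => //= c u; rewrite cat_path => /andP[-> ].
by case: v => //= d v /andP[].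
Qed.

Lemma phi_head_neq c v : alternating (c :: v) -> ohead (phi v) != Some (col c).
Proof.
case: v => // d v /= /andP[cd _]; rewrite phi_cons.
by move: cd; case: c; case: d.
Qed.

(** Each coded block is constant, so two different neighbouring letters of [phi v] lie in different
    blocks. This transfers block boundaries seen in a sequence to the word of codes. *)
Lemma phi_cut v P Q a b : phi v = rcons P a ++ b :: Q -> a <> b ->
  exists v1 v2, [/\ v = v1 ++ v2, phi v1 = rcons P a & phi v2 = b :: Q].
Proof.
move=> + ab; elim: v P => [|c v IH] P; first by case: P.
rewrite phi_cons => E.
have [le|lt] := leqP (size (rcons P a)) (len c).
  have := congr1 (take (size (rcons P a))) E.
  rewrite [RHS]take_size_cat // take_cat size_nseq.
  have [lt|ge] := ltnP (size (rcons P a)) (len c).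
    rewrite take_nseq; last exact: ltnW.
    move=> Ea.
    have ea : a = col c.
      have : a \in rcons P a by rewrite mem_rcons inE eqxx.
      by rewrite -Ea => /nseqP[].
    have := congr1 (nth 0 ^~ (size (rcons P a))) E.
    rewrite nth_cat size_nseq lt nth_nseq lt nth_cat ltnn subnn /= -ea.
    by move=> /ab.
  have -> : size (rcons P a) = len c by apply/eqP; rewrite eqn_leq le.
  rewrite subnn take0 cats0 => Ea.
  exists [:: c], v; split=> //; first by rewrite /phi /= cats0.
  move: E; rewrite -Ea => /eqP; rewrite eqseq_cat // eqxx /= => /eqP.
  by [].
have := congr1 (drop (len c)) E.
rewrite [LHS]drop_size_cat ?size_nseq // drop_cat lt drop_rcons; last first.
  by move: lt; rewrite size_rcons ltnS.
move=> /IH[v1 [v2 [-> E1 E2]]]; exists (c :: v1), v2; split => //.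
rewrite phi_cons E1 -drop_rcons; last by move: lt; rewrite size_rcons ltnS.
have := congr1 (take (len c)) E.
rewrite [LHS]take_size_cat ?size_nseq // take_cat lt => ->.
by rewrite cat_take_drop.
Qed.

(** A leading maximal run is unique: the conditions on [ohead] say that neither run continues into
    the remainder. *)
Lemma nseq_cat_inj (l m a b : nat) (A B : seq nat) : 0 < l -> 0 < m ->
  ohead A != Some a -> ohead B != Some b ->
  nseq l a ++ A = nseq m b ++ B -> [/\ l = m, a = b & A = B].
Proof.
move=> l0 m0 hA hB E.
have ab : a = b by case: l m l0 m0 E {hA hB} => // l [] // m _ _ [].
rewrite -{b}ab in hB E *.
suff [-> ->] : l = m /\ A = B by [].
elim: l m {l0 m0} E => [|l IH] [|m] //=.
- by move=> e; rewrite e /= eqxx in hA.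
- by move=> e; rewrite -e /= eqxx in hB.
- by case=> /IH[-> ->].
Qed.

(** Blocks have length at most 3 and neighbouring blocks differ. This bounds the blocks of a
    sequence known only through its factors. *)
Lemma phi_no_square4 v P Q a :
  alternating v -> phi v = P ++ nseq 4 a ++ Q -> False.
Proof.
elim: v P => [|c v IH] P av; first by case: P.
rewrite phi_cons => E.
have [le|lt] := leqP (len c) (size P).
  have E2 := congr1 (drop (len c)) E.
  move: E2; rewrite [LHS]drop_size_cat ?size_nseq // drop_cat.
  move: le; rewrite leq_eqVlt => /orP[/eqP ->|->].
    rewrite ltnn subnn drop0 => /(IH [::]); apply.
    by move: av => /= /path_sorted.
  by move/IH; apply; move: av => /= /path_sorted.
have ac : a = col c.
  have := congr1 (nth 0 ^~ (size P)) E.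
  by rewrite nth_cat size_nseq lt nth_nseq lt nth_cat ltnn subnn.
have := congr1 (nth 0 ^~ (len c)) E.
rewrite nth_cat size_nseq ltnn subnn nth_cat ltnNge (ltnW lt) nth_cat size_nseq.
have -> : len c - size P < 4 by move: lt; case: (c) => /=; lia.
rewrite nth_nseq.
have -> : len c - size P < 4 by move: lt; case: (c) => /=; lia.
have := phi_head_neq av; rewrite -ac; case: (phi v) E => [|b s] E /=.
  move=> _ _; move: (congr1 size E) lt; rewrite cats0 !size_cat !size_nseq.
  by case: (c) => /=; lia.
by move=> /eqP + ba; rewrite ba.
Qed.

(** * Desubstitution of smooth sequences *)

Definition altcol (a j : nat) : nat := if odd j then 4 - a else a.

(* [x'] is the sequence of run lengths of [x]; the [M]-th run starts at the sum
   of the first [M] lengths, and runs alternate between [x 0] and [4 - x 0]. *)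
Definition desub (x x' : nat -> nat) : Prop :=
  forall M i, i < x' M -> x (\sum_(j < M) x' j + i) = altcol (x 0) M.

Definition rec1 (a : nat) (x' : nat -> nat) (j : nat) : code :=
  block_code (altcol a j) (x' j).

Lemma letter_altcol a j : letter a -> letter (altcol a j).
Proof. by rewrite /altcol => /letterP[]->; case: odd. Qed.

Lemma altcolS a j : letter a -> altcol a j.+1 = 4 - altcol a j.
Proof. by rewrite /altcol /= => /letterP[]->; case: odd. Qed.

Lemma letter_neq a b : letter a -> letter b -> a <> b -> a = 4 - b.
Proof. by move=> /letterP[]-> /letterP[]->. Qed.

Lemma mkseq_add T (f : nat -> T) n k :
  mkseq f (n + k) = mkseq f n ++ mkseq (fun i => f (n + i)) k.
Proof.
by rewrite /mkseq iotaD add0n map_cat -[in X in _ ++ X](addn0 n) iotaDl -map_comp.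
Qed.

Lemma desub_run x x' s : is_run_starts x s -> (forall n, letter (x n)) ->
  (forall j, x' j = s j.+1 - s j) -> desub x x'.
Proof.
move=> [s0 slt seq sne] lx x'E.
have sE M : \sum_(j < M) x' j = s M.
  elim: M => [|M IH]; first by rewrite big_ord0 s0.
  by rewrite big_ord_recr /= IH x'E; move: (slt M); lia.
have cE M : x (s M) = altcol (x 0) M.
  elim: M => [|M IH]; first by rewrite s0.
  by rewrite altcolS // -IH; apply: letter_neq.
move=> M i; rewrite sE x'E -cE => lt; apply: seq.
by move: (slt M); lia.
Qed.

Lemma desub_phi x x' M : desub x x' -> letter (x 0) -> (forall n, letter (x' n)) ->
  mkseq x (\sum_(j < M) x' j) = phi (mkseq (rec1 (x 0) x') M).
Proof.
move=> D lx lx'; elim: M => [|M IH]; first by rewrite big_ord0.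
rewrite big_ord_recr /= mkseq_add IH mkseqS -cats1 phi_cat phi_cons cats0.
rewrite /rec1 col_block_code ?len_block_code ?letter_altcol //.
congr (_ ++ _); apply: (@eq_from_nth _ 0) => [|i]; rewrite size_mkseq ?size_nseq //.
by move=> lt; rewrite nth_mkseq // nth_nseq lt; apply: D.
Qed.

(** Run lengths are odd, so the [M]-th run of [x'] starts at an index of the parity of [M]. Hence
    the colour and the length of the code standing there both switch when [M] increases by 1, and
    whether they agree is decided at index 0: this is the type. *)
Lemma desub_subst a x' x'' M : desub x' x'' -> letter a -> letter (x' 0) ->
  (forall n, letter (x'' n)) ->
  mkseq (rec1 a x') (\sum_(j < M) x'' j) =
  subst (a != x' 0) (mkseq (rec1 (x' 0) x'') M).
Proof.
move=> D la lx' lx''.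
have par N : odd (\sum_(j < N) x'' j) = odd N.
  elim: N => [|N IH]; first by rewrite big_ord0.
  by rewrite big_ord_recr /= oddD IH; case/letterP: (lx'' N) => ->; rewrite addbT.
elim: M => [|M IH]; first by rewrite big_ord0.
rewrite big_ord_recr /= mkseq_add IH mkseqS -cats1 subst_cat subst_cons cats0.
congr (_ ++ _); move: (D M) => {D IH}.
rewrite /rec1; have := par M; set S := \sum_(j < M) x'' j => SM DM.
have aE i : i < x'' M -> altcol a (S + i) = altcol (altcol a i) M.
  by move=> _; rewrite /altcol oddD SM; case/letterP: la => ->; case: (odd M); case: (odd i).
have -> : mkseq (fun i => block_code (altcol a (S + i)) (x' (S + i))) (x'' M)
   = mkseq (fun i => block_code (altcol (altcol a i) M) (altcol (x' 0) M)) (x'' M).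
  by apply/eq_in_map => i; rewrite mem_iota add0n => /= lt; rewrite DM // aE.
rewrite /altcol.
by case/letterP: (lx'' M) => ->; case/letterP: la => ->; case/letterP: lx' => ->;
  case: (odd M).
Qed.

(* [x] can be desubstituted [n] times, with types [tau 0], ..., [tau (n-1)]: for
   sequences cut at the start of a block, the type is read off the first letters. *)
Fixpoint tower (n : nat) (tau : nat -> bool) (x : nat -> nat) : Prop :=
  (forall i, letter (x i)) /\
  if n is m.+1 then
    exists x', [/\ desub x x', tau 0 = (x 0 != x' 0) & tower m (tau \o succn) x']
  else True.

Lemma tower_letter n tau x : tower n tau x -> forall i, letter (x i).
Proof. by case: n => [|n] []. Qed.

Lemma leq_sum_letter (x' : nat -> nat) M : (forall n, letter (x' n)) -> M <= \sum_(j < M) x' j.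
Proof.
move=> lx; elim: M => // M IH; rewrite big_ord_recr /=.
by rewrite -addn1 leq_add //; case/letterP: (lx M) => ->.
Qed.

Lemma alternating_rec1 a x' N : letter a -> (forall n, letter (x' n)) ->
  alternating (mkseq (rec1 a x') N).
Proof.
move=> la lx; rewrite /alternating; apply/(sortedP (rec1 a x' 0)) => i.
rewrite size_mkseq => lt; rewrite !nth_mkseq //; last exact: ltnW.
rewrite /rec1 !col_block_code ?letter_altcol // altcolS //.
by case/letterP: (letter_altcol i la) => ->.
Qed.

(** A prefix of the recoding may end inside the image of a letter; [q] completes it to a full image.
    Taking [N] letters one level deeper suffices, since substitution never shortens. *)
Lemma tower_rec n tau x x' : tower n (tau \o succn) x' -> desub x x' ->
  letter (x 0) -> tau 0 = (x 0 != x' 0) ->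
  forall N, exists u q, [/\ alternating u, N <= size (mkseq (rec1 (x 0) x') N) &
    mkseq (rec1 (x 0) x') N ++ q = substs tau n u].
Proof.
elim: n tau x x' => [|n IH] tau x x' T D lx t0 N.
  exists (mkseq (rec1 (x 0) x') N), [::].
  rewrite size_mkseq cats0; split => //; apply: alternating_rec1 => //.
  exact: tower_letter T.
case: T => lx' [x'' [D' t1 T']].
have [u [q [au _ E]]] := IH _ _ _ T' D' (lx' 0) t1 N.
have lx'' := tower_letter T'.
rewrite size_mkseq /=.
have le := leq_sum_letter N lx''.
exists u, (mkseq (fun i => rec1 (x 0) x' (N + i)) (\sum_(j < N) x'' j - N) ++
           subst (tau 0) q).
split=> //; rewrite catA -mkseq_add subnKC // desub_subst // -t0 -subst_cat.
by congr subst.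
Qed.

(** One desubstitution is spent on passing from [x] to its recoding, undone by [phi]; the other [n]
    undo the substitutions. *)
Lemma tower_lang n tau x N : tower n.+1 tau x -> lang tau n (mkseq x N).
Proof.
case=> lx [x' [D t0 T]]; have lx' := tower_letter T.
have [u [q [au _ E]]] := tower_rec T D (lx 0) t0 N.
exists u => //; rewrite -E phi_cat -desub_phi //.
have le := leq_sum_letter N lx'; rewrite -(subnKC le) mkseq_add -catA.
by rewrite -[mkseq x N ++ _]cat0s; apply: infix_infix.
Qed.

Lemma lang_infix tau n U W : infix U W -> lang tau n W -> lang tau n U.
Proof. by move=> UW [u au Wu]; exists u => //; apply: infix_trans UW Wu. Qed.

Lemma langW tau m n W : m <= n -> lang tau n W -> lang tau m W.
Proof.
move=> /subnKC <- [u au Wu]; move: Wu; rewrite substsD => Wu.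
by exists (substs (fun k => tau (m + k)) (n - m) u) => //; apply: substs_alternating.
Qed.

Lemma run_startsP x : ~ eventually_constant x -> is_run_starts x (run_starts x).
Proof.
move=> ec; apply: xgetPex.
have nx i : exists j, (i < j) && (x j != x i).
  apply: contrapT => H; apply: ec; exists i => n; rewrite leq_eqVlt.
  case/orP => [/eqP <- //|lt]; apply: contrapT => ne; apply: H; exists n.
  by rewrite lt; apply/eqP.
pose s := fix s k := if k is k'.+1 then ex_minn (nx (s k')) else 0.
exists s; split => // k.
- by rewrite /=; case: ex_minnP => m /andP[].
- move=> i; rewrite /=; case: ex_minnP => m _ H /andP[le lt].
  move: le; rewrite leq_eqVlt => /orP[/eqP <- //|lt'].
  by apply/eqP; apply: contraTT lt => ne; rewrite -leqNgt H // lt'.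
- by rewrite /=; case: ex_minnP => m /andP[_ /eqP].
Qed.

(** Position 0 starts a run at every level, so the types are read off the successive first
    letters. *)
Lemma smooth_tower x : smooth x ->
  forall n k, tower n (fun j => iter (k + j) delta x 0 != iter (k + j).+1 delta x 0)
    (iter k delta x).
Proof.
move=> sx; elim=> [|n IH] k; split=> //; try exact: (sx k).1.
exists (iter k.+1 delta x); split => //.
- have [lk ek] := sx k.
  exact: (desub_run (run_startsP ek)).
- by rewrite addn0.
have := IH k.+1; congr tower; apply/funext => j /=.
by rewrite addnS.
Qed.

Lemma smooth_lang x : smooth x ->
  exists tau, forall n N, lang tau n (mkseq x N).
Proof.
move=> /smooth_tower T; exists (fun j => iter j delta x 0 != iter j.+1 delta x 0) => n N.
by apply: tower_lang; apply: (T _ 0).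
Qed.

(** * Bi-infinite smooth sequences *)

Section BiInfinite.
Local Open Scope ring_scope.

Lemma block_startsP x : finite_blocks x -> is_block_starts x (block_starts x).
Proof.
move=> fb; apply: xgetPex.
have nxP i : exists m : nat, x (i + m.+1%:Z) != x i.
  have [[j lt /eqP ne] _] := fb i; exists (`|j - i|%N.-1).
  by have -> : i + (`|j - i|%N.-1).+1%:Z = j by lia.
have pvP i : exists m : nat, x (i - m.+1%:Z) != x i.
  have [_ [j lt /eqP ne]] := fb i; exists (`|j - i|%N.-1).
  by have -> : i - (`|j - i|%N.-1).+1%:Z = j by lia.
(* [nx i] is the start of the block following that of [i], and [pv i] the start of the block
   containing [i]. *)
pose nx i := i + (ex_minn (nxP i)).+1%:Z.
pose pv i := i - (ex_minn (pvP i))%:Z.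
have nxH i : [/\ i < nx i, forall l, i <= l < nx i -> x l = x i & x (nx i) <> x i].
  rewrite /nx; case: ex_minnP => m /eqP ne H; split=> //; first by lia.
  move=> l /andP[le lt]; case: (eqVneq l i) => [-> //|li].
  apply/eqP; apply: contraT => nel; have := H `|l - i|%N.-1.
  by have -> : i + (`|l - i|.-1).+1%:Z = l; [lia|move=> /(_ nel); lia].
have pvH i : [/\ pv i <= i, forall l, pv i <= l <= i -> x l = x i & x (pv i - 1) <> x i].
  rewrite /pv; case: ex_minnP => m /eqP ne H; split; first by lia.
    move=> l /andP[le lt]; case: (eqVneq l i) => [-> //|li].
    apply/eqP; apply: contraT => nel; have := H `|l - i|%N.-1.
    by have -> : i - (`|l - i|.-1).+1%:Z = l; [lia|move=> /(_ nel); lia].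
  by have -> : i - m%:Z - 1 = i - m.+1%:Z by lia.
(* To the left, the next block is the one containing the letter just before the current start. *)
pose s k := match k with
  | Posz n => iter n nx (pv 0)
  | Negz n => iter n.+1 (fun i => pv (i - 1)) (pv 0) end.
have sneg n : exists2 i, s (Negz n) = pv i & s (Negz n + 1) = i + 1.
  exists (s (Negz n + 1) - 1); last by lia.
  by case: n => [|n] //; have -> : Negz n.+1 + 1 = Negz n by lia.
have cst i l : pv i <= l <= i -> x l = x (pv i).
  have [le H _] := pvH i; move=> /H ->; symmetry; apply: H; lia.
have sb n : x (s (Negz n + 1) - 1) <> x (s (Negz n + 1)).
  have [i e] : exists i, s (Negz n + 1) = pv i.
    case: n => [|n]; first by exists 0.
    by have -> : Negz n.+1 + 1 = Negz n; [lia|have [i] := sneg n; exists i].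
  by have [le H ne] := pvH i; rewrite e (H (pv i)) // lexx.
exists s; split.
- have [le H _] := pvH 0; rewrite le /=; have [lt H2 ne] := nxH (pv 0).
  rewrite ltNge; apply/negP => le2; apply: ne; rewrite (cst 0) //.
  by rewrite (ltW lt).
- case=> n; first by have [] := nxH (s n); rewrite -PoszD addn1.
  by have [i -> ->] := sneg n; have [] := pvH i; lia.
- case=> n; first by have [_ + _] := nxH (s n); rewrite -PoszD addn1.
  have [i -> ->] := sneg n => l; move=> lt; apply: cst; lia.
- case=> n; first by have [_ _] := nxH (s n); rewrite -PoszD addn1.
  have := sb n; have [i -> ->] := sneg n; have -> : i + 1 - 1 = i by lia.
  by rewrite (cst i i) ?lexx ?andbT; [move=> h e; apply: h|have [] := pvH i].
Qed.

Definition fac T (x : int -> T) (j : int) (N : nat) : seq T :=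
  mkseq (fun i => x (j + i%:Z)) N.

Lemma fac_cat T (x : int -> T) j m n : fac x j (m + n) = fac x j m ++ fac x (j + m%:Z) n.
Proof.
by rewrite /fac mkseq_add; congr (_ ++ _); apply: eq_map => i; rewrite PoszD addrA.
Qed.

Lemma size_fac T (x : int -> T) j n : size (fac x j n) = n.
Proof. exact: size_mkseq. Qed.

Lemma int_const T (f : int -> T) : (forall k, f (k + 1) = f k) -> forall k, f k = f 0.
Proof.
move=> H; case=> n; elim: n => [|n IH] //.
- by rewrite -addn1 PoszD H.
- by rewrite -H.
- by rewrite -H -IH; congr f; lia.
Qed.

Section Blocks.
Variables (x : int -> nat) (fb : finite_blocks x).
Local Notation s := (block_starts x).

Lemma block_starts_lt (k : int) : s k < s (k + 1).
Proof. by have [] := block_startsP fb. Qed.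

Lemma block_starts_eq (k i : int) : s k <= i < s (k + 1) -> x i = x (s k).
Proof. by have [_ _ + _] := block_startsP fb; apply. Qed.

Lemma block_starts_neq (k : int) : x (s (k + 1)) <> x (s k).
Proof. by have [] := block_startsP fb. Qed.

Lemma block_starts_Delta (k : int) : s (k + 1) = s k + (Delta x k)%:Z.
Proof. by rewrite /Delta; move: (block_starts_lt k); lia. Qed.

Lemma block_starts_mono (k : int) (n : nat) : s k + n%:Z <= s (k + n%:Z).
Proof.
elim: n => [|n IH]; first by rewrite !(addr0 _).
have := block_starts_lt (k + n%:Z); have -> : k + n.+1%:Z = k + n%:Z + 1 by lia.
by lia.
Qed.

Lemma block_starts_le (k : int) : k <= 0 -> s k <= k.
Proof.
move=> k0; have [/andP[s0 _] _ _ _] := block_startsP fb.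
by have := block_starts_mono k `|k|%N; have -> : k + `|k|%N%:Z = 0; lia.
Qed.

Lemma desub_block (k : int) : (forall i, letter (x i)) ->
  desub (fun i => x (s k + i%:Z)) (fun j => Delta x (k + j%:Z)).
Proof.
move=> lx; apply: (@desub_run _ _ (fun j => `|s (k + j%:Z) - s k|%N)) => [|//|j].
  have E j : s k + `|s (k + j%:Z) - s k|%N%:Z = s (k + j%:Z).
    by have := block_starts_mono k j; lia.
  have S j : k + j.+1%:Z = k + j%:Z + 1 by lia.
  split => [|j|j i|j]; rewrite ?E.
  - by rewrite addr0 subrr.
  - by have := block_starts_lt (k + j%:Z); have := block_starts_mono k j; rewrite S; lia.
  - move=> lt; apply: block_starts_eq; rewrite -S.
    by move: (E j) (E j.+1) lt; lia.
  - by rewrite S; apply: block_starts_neq.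
have := block_starts_mono k j; have := block_starts_Delta (k + j%:Z).
have -> : k + j.+1%:Z = k + j%:Z + 1 by lia.
by lia.
Qed.

End Blocks.

Lemma bismooth_Delta x : bismooth x -> bismooth (Delta x).
Proof. by move=> bx k; rewrite -iterSr; apply: bx. Qed.

Lemma bismooth_letter x : bismooth x -> forall i, letter (x i).
Proof. by move=> bx; have [] := bx 0%N. Qed.

Lemma bismooth_finite_blocks x : bismooth x -> finite_blocks x.
Proof. by move=> bx; have [] := bx 0%N. Qed.

Lemma Xtype_Delta tau x : Xtype tau x -> Xtype (tau \o succn) (Delta x).
Proof.
case=> bx tx; split; first exact: bismooth_Delta.
by move=> n; rewrite -iterSr; apply: tx.
Qed.

(* In type 0 the letters 1 and 3 of [Delta x] at the start of a block stand over
   blocks of 1s and of 3s respectively; in type 1 it is the other way round. *)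
Definition block_type (x : int -> nat) (k : int) : bool :=
  x (block_starts x (block_starts (Delta x) k)) != Delta x (block_starts (Delta x) k).

(** Passing to the next block of [Delta x] changes the letter of [Delta x]. It also passes over one
    or three blocks of [x], an odd number, so the letter of [x] changes as well and the comparison
    keeps its outcome. *)
Lemma block_type_const x : bismooth x -> forall k, block_type x k = block_type x 0.
Proof.
move=> bx; have bx' := bismooth_Delta bx; have bx'' := bismooth_Delta bx'.
have fx := bismooth_finite_blocks bx; have fx' := bismooth_finite_blocks bx'.
have lx := bismooth_letter bx; have lx' := bismooth_letter bx'.
have lx'' := bismooth_letter bx''.
apply: int_const => k; rewrite /block_type.
have := letter_neq (lx' _) (lx' _) (@block_starts_neq _ fx' k).
rewrite block_starts_Delta //.
have step j : x (block_starts x (j + 1)) = (4 - x (block_starts x j))%N.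
  by apply: letter_neq (lx _) (lx _) _; apply: block_starts_neq.
case/letterP: (lx'' k) => -> ->.
  rewrite step.
  by case/letterP: (lx (block_starts x (block_starts (Delta x) k))) => ->;
     case/letterP: (lx' (block_starts (Delta x) k)) => ->.
set j := block_starts (Delta x) k.
have -> : j + 3%N%:Z = j + 1 + 1 + 1 by lia.
rewrite !step.
by case/letterP: (lx (block_starts x j)) => ->; case/letterP: (lx' j) => ->.
Qed.

(** The first code of an elementary block decides: colour and length agree for [cA] and [cD], and
    differ for [cB] and [cC]. *)
Lemma has_type_block_type x b : bismooth x -> has_type x b -> forall k, b = block_type x k.
Proof.
move=> bx [k0 H] k; rewrite block_type_const // -(block_type_const bx k0) {k}.
have bx' := bismooth_Delta bx.
have lx := bismooth_letter bx; have lx' := bismooth_letter bx'.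
set k := k0 in H *; clearbody k.
have : exists2 c, block_code (x (block_starts x (block_starts (Delta x) k)))
    (Delta x (block_starts (Delta x) k)) = c & (col c != len c) = b.
  move: H; rewrite /elementary_block.
  case: (Delta _ k) => [|m]; first by case: b => -[].
  rewrite /mkseq /= addr0 /recode.
  by case: b => -[] [-> _]; eexists; try reflexivity.
move=> [c + <-]; rewrite /block_type => <-.
by rewrite col_block_code // len_block_code.
Qed.

(** To cut [x], [Delta x], ... simultaneously at block starts, the cut is chosen at the deepest
    level and carried back up. At indices at most 0 a block start never exceeds its index, so the
    cut stays to the left of [j]. *)
Lemma Xtype_tower n tau x : Xtype tau x -> forall j, j <= 0 ->
  exists2 k, block_starts x k <= j & tower n tau (fun i => x (block_starts x k + i%:Z)).
Proof.
elim: n tau x => [|n IH] tau x Xx j j0; have bx := Xx.1;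
  have fx := bismooth_finite_blocks bx; have lx := bismooth_letter bx.
  by exists j => //; apply: block_starts_le.
have [k' le T] := IH _ _ (Xtype_Delta Xx) j j0.
exists (block_starts (Delta x) k').
  by have := @block_starts_le _ fx (block_starts (Delta x) k'); lia.
split => //; eexists; split; [exact: desub_block| |exact: T].
rewrite !addr0 (has_type_block_type bx (Xx.2 0%N) k') //.
Qed.

Lemma Xtype_lang tau x : Xtype tau x -> forall n j N, lang tau n (fac x j N).
Proof.
move=> Xx n j N.
have j0 : - `|j| <= 0 by lia.
have [k le T] := Xtype_tower n.+1 Xx j0.
have := tower_lang (`|(j - block_starts x k)%R|%N + N) T; apply: lang_infix.
set f := fun i => _; rewrite -[mkseq f _]/(fac x _ _) fac_cat.
have -> : block_starts x k + `|(j - block_starts x k)%R|%N%:Z = j by lia.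
by rewrite -[X in _ ++ X]cats0; apply: infix_infix.
Qed.

Lemma fac_cons T (x : int -> T) (j : int) n : fac x j n.+1 = x j :: fac x (j + 1) n.
Proof. by rewrite -add1n fac_cat /fac /= addr0. Qed.

(** [has_type] needs an elementary block of length 3. One exists because [Delta (Delta x)] is not
    constant, its blocks being finite. *)
Lemma bismooth_has_type x : bismooth x -> has_type x (block_type x 0).
Proof.
move=> bx; have bx' := bismooth_Delta bx; have bx'' := bismooth_Delta bx'.
have fx := bismooth_finite_blocks bx; have fx' := bismooth_finite_blocks bx'.
have lx := bismooth_letter bx; have lx' := bismooth_letter bx'.
have lx'' := bismooth_letter bx''.
have [k k3] : exists k, Delta (Delta x) k = 3%N.
  have [[j _ ne] _] := bismooth_finite_blocks bx'' 0.
  case/letterP: (lx'' 0) ne; last by exists 0.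
  by case/letterP: (lx'' j) => e -> //; exists j.
exists k; rewrite -(block_type_const bx k) /block_type /elementary_block k3.
have step j : x (block_starts x (j + 1)) = (4 - x (block_starts x j))%N.
  by apply: letter_neq (lx _) (lx _) _; apply: block_starts_neq.
set j := block_starts (Delta x) k.
have D i : (i < 3)%N -> Delta x (j + i%:Z) = Delta x j.
  move=> lt; apply: (@block_starts_eq _ fx' k).
  by rewrite block_starts_Delta // k3 -/j; lia.
rewrite /mkseq /= /recode !D //.
have -> : j + 2%N%:Z = j + 1 + 1 by lia.
have -> : j + 0%N%:Z = j by lia.
rewrite !step.
by case/letterP: (lx (block_starts x j)) => ->; case/letterP: (lx' j) => -> /=; auto.
Qed.

(** * Admissible factors at every level imply smoothness *)

Definition local_in (tau : nat -> bool) (x : int -> nat) : Prop :=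
  forall n j N, lang tau n (fac x j N).

Lemma lang_word tau n W : lang tau n W -> word W.
Proof.
move=> [u _ iW]; have := all_letter_phi (substs tau n u).
by move/allP => H; apply/allP => a aW; apply: H; apply: mem_infix aW.
Qed.

Lemma local_letter tau x : local_in tau x -> forall i, letter (x i).
Proof. by move=> /(_ 0%N _ 1%N) H i; have /andP[] := lang_word (H i); rewrite addr0. Qed.

Lemma local_finite_blocks tau x : local_in tau x -> finite_blocks x.
Proof.
move=> Lx.
have no4 (j : int) a : (forall i : nat, (i < 4)%N -> x (j + i%:Z) = a) -> False.
  move=> H; have [u au /infixP[P [Q E]]] := Lx 0%N j 4%N.
  apply: (phi_no_square4 (P := P) (Q := Q) (a := a) au).
  rewrite (E : phi u = _); congr (P ++ (_ ++ Q)).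
  by apply: (@eq_from_nth _ 0%N) => [|i]; rewrite size_fac ?size_nseq // => lt;
    rewrite nth_mkseq // nth_nseq lt H.
move=> i; split; apply: contrapT => H.
  apply: (no4 i (x i)) => k _; apply: contrapT => ne; apply: H.
  exists (i + k%:Z) => //; case: k ne => [|k]; last by lia.
  by rewrite (_ : i + 0%N%:Z = i) //; lia.
apply: (no4 (i - 3%:Z) (x i)) => k k4; apply: contrapT => ne; apply: H.
exists (i - 3%:Z + k%:Z) => //; case: (ltnP k 3) => [|k3]; first by lia.
by move: ne; rewrite (_ : i - 3%:Z + k%:Z = i) //; lia.
Qed.

(* The extra letter [.+1] of the window marks the end of its last block. *)
Lemma phi_recode (x : int -> nat) (fb : finite_blocks x) N (i : int) v Q :
  alternating v ->
  phi v = fac x (block_starts x i)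
            `|block_starts x (i + N%:Z) - block_starts x i|%N.+1 ++ Q ->
  exists2 v', v = fac (recode x) i N ++ v' &
    map len (fac (recode x) i N) = fac (Delta x) i N.
Proof.
elim: N i v => [|N IH] i v av; first by exists v.
have S1 : i + N.+1%:Z = i + 1 + N%:Z by lia.
rewrite S1; set s := block_starts x.
have le := block_starts_mono fb (i + 1) N.
have sD := block_starts_Delta fb i.
have -> : `|s (i + 1 + N%:Z)%R - s i|%N.+1 =
          (Delta x i + `|s (i + 1 + N%:Z)%R - s (i + 1)%R|.+1)%N.
  by rewrite /s; lia.
rewrite fac_cat -sD -catA.
have -> : fac x (block_starts x i) (Delta x i) = nseq (Delta x i) (x (s i)).
  apply: (@eq_from_nth _ 0%N) => [|k]; rewrite size_fac ?size_nseq // => lt.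
  rewrite nth_mkseq // nth_nseq lt; apply: (block_starts_eq fb).
  by rewrite sD; lia.
have D0 : (0 < Delta x i)%N by have := block_starts_lt fb i; lia.
case: v av => [|c v] av; first by case: (Delta x i) D0.
rewrite phi_cons => /nseq_cat_inj[||||lE cE E] //; first exact: len_gt0.
- exact: phi_head_neq.
- rewrite fac_cons; apply/eqP => -[]; exact: (block_starts_neq fb).
have av' : alternating v by move: av => /= /path_sorted.
have [v' -> lE'] := IH _ _ av' E.
have cR : recode x i = c by rewrite /recode -cE -lE block_codeK.
rewrite !fac_cons cR; exists v' => //=.
by rewrite lE' lE.
Qed.

Lemma local_recode tau x n (i : int) N : local_in tau x ->
  exists u v1 v2, [/\ alternating u,
    substs tau n u = v1 ++ fac (recode x) i N ++ v2 &
    map len (fac (recode x) i N) = fac (Delta x) i N].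
Proof.
move=> Lx; have fb := local_finite_blocks Lx.
set s := block_starts x; pose M := `|(s (i + N%:Z) - s i)%R|%N.
(* Besides the blocks i, ..., i+N-1 the window contains the letter before and the letter after them:
   the former shows where block [i] begins, the latter where the last block ends. *)
have [u au /infixP[P [Q]]] := Lx n (s i - 1) (1 + M.+1)%N.
have s1 := block_starts_lt fb (i - 1).
have i1 : i - 1 + 1 = i by lia.
have ne : x (s i - 1) <> x (s i).
  rewrite (block_starts_eq fb (k := i - 1)); last by rewrite i1 in s1 *; rewrite /s; lia.
  by move=> e; have := @block_starts_neq _ fb (i - 1); rewrite i1; apply.
rewrite add1n !fac_cons subrK !cat_cons -cat_rcons => /phi_cut/(_ ne)[v1 [v2 [E E1 E2]]].
have [_ a2] : alternating v1 /\ alternating v2.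
  by apply: alternating_cat; rewrite -E; apply: substs_alternating.
have [|v' v2E lE] := @phi_recode x fb N i v2 Q a2.
  by rewrite E2 -/s -/M fac_cons.
by exists u, v1, v'; rewrite E v2E.
Qed.

(** The codes over a window of [Delta x] form a factor of the image under [sigma (tau 0)] of a word
    of level [n], and the lengths of these codes spell out [phi] of that word. *)
Lemma local_Delta tau x : local_in tau x -> local_in (tau \o succn) (Delta x).
Proof.
move=> Lx n i N; have [u [v1 [v2 [au /= E lE]]]] := local_recode n.+1 i N Lx.
exists u => //; rewrite -(map_len_subst (tau 0%N)) E !map_cat lE.
exact: infix_infix.
Qed.

(** At the index [j] the letter of [Delta x] changes, so the codes at [j - 1] and [j] have different
    lengths; [type_rel] then forces the type. *)
Lemma local_block_type tau x : local_in tau x -> block_type x 0 = tau 0%N.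
Proof.
move=> Lx; have Lx' := local_Delta Lx; have fb' := local_finite_blocks Lx'.
have lx := local_letter Lx; have lx' := local_letter Lx'.
set j := block_starts (Delta x) 0.
have [u [v1 [v2 [au E _]]]] := local_recode 1 (j - 1) 2 Lx.
have := subst_sorted (tau 0%N) au; rewrite -[subst _ u]/(substs tau 1 u) E.
have := @block_starts_neq _ fb' (-1); rewrite addNr -/j.
have -> : Delta x (block_starts (Delta x) (-1)) = Delta x (j - 1).
  apply/esym/(block_starts_eq fb'); rewrite addNr -/j.
  by have := block_starts_lt fb' (-1); rewrite addNr -/j; lia.
rewrite !fac_cons subrK => ne.
move=> /cat_sorted2[_ /cat_sorted2[+ _]].
move=> /= /andP[/andP[_ +] _].
rewrite /recode !col_block_code ?len_block_code //.
rewrite /block_type -/j => /implyP H; apply: (eqP (H _)).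
by apply/eqP => e; apply: ne.
Qed.

Lemma local_Xtype tau x : local_in tau x -> Xtype tau x.
Proof.
move=> Lx.
have LD k : local_in (fun n => tau (k + n)%N) (iter k Delta x).
  elim: k => [|k IH] //; move: (local_Delta IH); congr local_in.
  by apply/funext => n /=; rewrite addnS.
have bx : bismooth x.
  by move=> k; split; [exact: local_letter (LD k)|exact: local_finite_blocks (LD k)].
split=> // n; have bD : bismooth (iter n Delta x) by move=> k; rewrite -iterD; apply: bx.
by have := bismooth_has_type bD; rewrite (local_block_type (LD n)) addn0.
Qed.

Lemma XtypeE tau x : Xtype tau x <-> local_in tau x.
Proof. by split=> [/Xtype_lang|/local_Xtype]. Qed.

End BiInfinite.

(** * Letter frequencies *)

Definition num (a : code) (v : seq code) : nat :=
  count (fun c => match a, c with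
    | cA, cA | cB, cB | cC, cC | cD, cD => true | _, _ => false end) v.

Definition halfsize (v : seq code) : nat := num cA v + num cC v.

(* Holds for nonempty alternating words of even length. *)
Definition balanced (v : seq code) : Prop :=
  0 < halfsize v /\ halfsize v = num cB v + num cD v.

Lemma num_cat a u v : num a (u ++ v) = num a u + num a v.
Proof. exact: count_cat. Qed.

Lemma num_subst t v :
  [/\ num cA (subst t v) = (if t then num cC v else num cA v + (num cC v).*2),
      num cB (subst t v) = (if t then num cA v + (num cC v).*2 else num cC v),
      num cC (subst t v) = (if t then num cB v + (num cD v).*2 else num cD v) &
      num cD (subst t v) = (if t then num cD v else num cB v + (num cD v).*2)].
Proof.
elim: v => [|c v [IA IB IC ID]]; first by case: t.
rewrite subst_cons !num_cat {}IA {}IB {}IC {}ID.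
by case: t; case: c; rewrite /num /=; split; lia.
Qed.

Lemma halfsize_subst t v : balanced v ->
  halfsize (subst t v) = halfsize v + num cC v + num cD v.
Proof.
by case=> _; rewrite /halfsize; have [-> _ -> _] := num_subst t v; case: t; lia.
Qed.

Lemma balanced_subst t v : balanced v -> balanced (subst t v).
Proof.
move=> bv; case: (bv) => h0 hv; rewrite /balanced halfsize_subst //.
have [_ -> _ ->] := num_subst t v; move: h0 hv; rewrite /halfsize.
by case: t; split; lia.
Qed.

Lemma balanced_alternating v : alternating v -> ~~ odd (size v) -> 0 < size v ->
  balanced v.
Proof.
move=> av ev v0; suff H : num cA v + num cC v = num cB v + num cD v /\
    size v = num cA v + num cC v + num cB v + num cD v.
  by rewrite /balanced /halfsize; lia.
(* Two letters are removed at a time; such a pair has one letter of each colour. *)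
elim: {v}_.+1 {-2}v (ltnSn (size v)) av ev {v0} => // n IH [|c [|d v]] //= lt.
move=> /andP[cd dv]; rewrite negbK => ev.
have [||H1 H2] := IH v _ _ ev; first by lia.
  by case: v dv {lt ev} => //= e v /andP[].
by move: cd H1 H2; case: c dv => dv; case: d dv => //= _ _; rewrite /num /=; lia.
Qed.

(** * Contraction of the letter ratios *)

Section Freq.
Variable R : realType.
Local Open Scope ring_scope.

Definition ratC (v : seq code) : R := (num cC v)%:R / (halfsize v)%:R.
Definition ratD (v : seq code) : R := (num cD v)%:R / (halfsize v)%:R.

(* Every substituted balanced word is settled, and on settled words the
   substitutions contract the letter ratios. *)
Definition settled (v : seq code) : Prop := balanced v /\ 1 / 2 <= ratC v + ratD v.

Lemma rat_bounds v : balanced v ->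
  [/\ 0 <= ratC v, ratC v <= 1, 0 <= ratD v & ratD v <= 1].
Proof.
case=> h0 hv; have h0' : (0 : R) < (halfsize v)%:R by rewrite ltr0n.
split; rewrite /ratC /ratD ?divr_ge0 ?ler0n // ler_pdivrMr // mul1r ler_nat.
  by rewrite /halfsize; lia.
by rewrite hv; lia.
Qed.

Lemma numE v : balanced v ->
  [/\ (num cA v)%:R = (halfsize v)%:R * (1 - ratC v) :> R,
      (num cB v)%:R = (halfsize v)%:R * (1 - ratD v) :> R,
      (num cC v)%:R = (halfsize v)%:R * ratC v :> R &
      (num cD v)%:R = (halfsize v)%:R * ratD v :> R].
Proof.
case=> h0 hv; have h0' : (halfsize v)%:R != 0 :> R by rewrite pnatr_eq0 -lt0n.
rewrite /ratC /ratD !mulrBr !mulr1 ![_ * (_ / _)]mulrC !divfK //; split => //.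
  by rewrite /halfsize natrD; ring.
by rewrite hv natrD; ring.
Qed.

Lemma halfsize_subst_rat t v : balanced v ->
  (halfsize (subst t v))%:R = (halfsize v)%:R * (1 + ratC v + ratD v) :> R.
Proof.
move=> bv; rewrite halfsize_subst //; have [_ _ eC eD] := numE bv.
by rewrite 2!natrD eC eD; ring.
Qed.

Lemma rat_subst t v : balanced v ->
  let D := 1 + ratC v + ratD v in
  ratC (subst t v) = (if t then 1 + ratD v else ratD v) / D /\
  ratD (subst t v) = (if t then ratD v else 1 + ratD v) / D.
Proof.
move=> bv D; have [_ _ eC eD] := num_subst t v.
have [p0 p1 q0 q1] := rat_bounds bv.
have h0 : (halfsize v)%:R != 0 :> R by case: bv => h0 _; rewrite pnatr_eq0 -lt0n.
have D0 : D != 0 by rewrite gt_eqF // /D; clear eC eD; lra.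
rewrite [ratC (subst t v)]/ratC [ratD (subst t v)]/ratD halfsize_subst_rat // eC eD -/D.
have [_ nB nC nD] := numE bv.
have e1 : (num cB v + (num cD v).*2)%:R = (halfsize v)%:R * (1 + ratD v) :> R.
  by rewrite -addnn 2!natrD nB nD; ring.
by case: t {eC eD}; rewrite e1 nD; split; field; rewrite D0 h0.
Qed.

(** The new ratios add up to (1 + 2q) / (1 + p + q), which is at least 1/2 because p <= 1. *)
Lemma settled_subst t v : balanced v -> settled (subst t v).
Proof.
move=> bv; split; first exact: balanced_subst.
have [p0 p1 q0 q1] := rat_bounds bv; have [-> ->] := rat_subst t bv.
have D0 : 0 < 1 + ratC v + ratD v by lra.
by case: t; rewrite -mulrDl ler_pdivlMr //; lra.
Qed.

(** Over the common denominator, the numerator of each difference is a combination of q1 - q2 and p1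
    - p2 whose weights add up, in absolute value, to one of the two factors of that denominator.
    This factor cancels and the other is at least 3/2. *)
Lemma contraction (p1 q1 p2 q2 d : R) :
  0 <= p1 -> 0 <= q1 -> 0 <= p2 -> 0 <= q2 -> 1 / 2 <= p1 + q1 -> 1 / 2 <= p2 + q2 ->
  `|p1 - p2| <= d -> `|q1 - q2| <= d ->
  `|q1 / (1 + p1 + q1) - q2 / (1 + p2 + q2)| <= 2 / 3 * d /\
  `|(1 + q1) / (1 + p1 + q1) - (1 + q2) / (1 + p2 + q2)| <= 2 / 3 * d.
Proof.
move=> p10 q10 p20 q20 s1 s2 dp dq.
have D1 : 0 < 1 + p1 + q1 by lra.
have D2 : 0 < 1 + p2 + q2 by lra.
have d0 : 0 <= d by apply: le_trans dp.
have key (N D D' : R) : 0 < D -> 3 / 2 <= D' -> `|N| <= D * d ->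
    `|N / (D * D')| <= 2 / 3 * d.
  move=> hD hD' hN; have hD'0 : 0 < D' by lra.
  rewrite normrM normfV (gtr0_norm (mulr_gt0 hD hD'0)) ler_pdivrMr ?mulr_gt0 //.
  apply: le_trans hN _.
  have -> : 2 / 3 * d * (D * D') = D * d * (2 / 3 * D') by ring.
  by rewrite ler_peMr ?mulr_ge0 ?(ltW hD) //; lra.
split.
  have -> : q1 / (1 + p1 + q1) - q2 / (1 + p2 + q2) =
    ((q1 - q2) * (1 + p2) - q2 * (p1 - p2)) / ((1 + p2 + q2) * (1 + p1 + q1)).
    by field; rewrite !gt_eqF.
  apply: key => //; first by lra.
  apply: le_trans (ler_normB _ _) _; rewrite !normrM.
  have -> : (1 + p2 + q2) * d = d * (1 + p2) + q2 * d by ring.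
  rewrite (ger0_norm q20) (ger0_norm (_ : 0 <= 1 + p2)); last by lra.
  by apply: lerD; [apply: ler_wpM2r => //; lra|apply: ler_wpM2l].
have -> : (1 + q1) / (1 + p1 + q1) - (1 + q2) / (1 + p2 + q2) =
  (p1 * (q1 - q2) - (1 + q1) * (p1 - p2)) / ((1 + p1 + q1) * (1 + p2 + q2)).
  by field; rewrite !gt_eqF.
apply: key => //; first by lra.
apply: le_trans (ler_normB _ _) _; rewrite !normrM.
have -> : (1 + p1 + q1) * d = p1 * d + (1 + q1) * d by ring.
rewrite (ger0_norm p10) (ger0_norm (_ : 0 <= 1 + q1)); last by lra.
by apply: lerD; apply: ler_wpM2l => //; lra.
Qed.

Definition close (d : R) (v w : seq code) : Prop :=
  `|ratC v - ratC w| <= d /\ `|ratD v - ratD w| <= d.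

Lemma close_subst t d v w : settled v -> settled w -> close d v w ->
  close (2 / 3 * d) (subst t v) (subst t w).
Proof.
move=> [bv sv] [bw sw] [hC hD]; rewrite /close.
have [p0 _ q0 _] := rat_bounds bv; have [p0' _ q0' _] := rat_bounds bw.
have [-> ->] := rat_subst t bv; have [-> ->] := rat_subst t bw.
by have [] := contraction p0 q0 p0' q0' sv sw hC hD; case: t.
Qed.

Lemma settled_substs tau n v : settled v -> settled (substs tau n v).
Proof.
move=> sv; elim: n tau => //= n IH tau; apply: settled_subst.
by have [] := IH (tau \o succn).
Qed.

Lemma close_substs tau n v w : settled v -> settled w ->
  close ((2 / 3) ^+ n) (substs tau n v) (substs tau n w).
Proof.
move=> sv sw; elim: n tau => [|n IH] tau /=; last first.
  by rewrite exprS; apply: close_subst (IH _); apply: settled_substs.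
have [p0 p1 q0 q1] := rat_bounds sv.1; have [p0' p1' q0' q1'] := rat_bounds sw.1.
by rewrite expr0; split; rewrite ler_norml; apply/andP; split; lra.
Qed.

Lemma substs_snoc tau n v :
  substs tau n.+1 v = substs tau n (subst (tau n) v).
Proof. by rewrite -addn1 substsD /= addn0. Qed.

(** Each substitution multiplies [halfsize] by 1 + p + q, at least 3/2 on settled words. *)
Lemma halfsize_substs tau n v : settled v ->
  (3 / 2) ^+ n * (halfsize v)%:R <= (halfsize (substs tau n v))%:R :> R.
Proof.
move=> sv; elim: n tau => [|n IH] tau; first by rewrite expr0 mul1r.
have [bw sw] := settled_substs (tau \o succn) n sv.
rewrite /= halfsize_subst_rat // exprSr -mulrA mulrCA mulrC -mulrA.
have := IH (tau \o succn); set a := _ ^+ n; set b := (halfsize v)%:R.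
set c := (halfsize _)%:R => ab.
have c0 : 0 <= c by rewrite ler0n.
apply: (@le_trans _ _ (c * (3 / 2))); first by lra.
by apply: ler_wpM2l => //; lra.
Qed.

End Freq.

(** * Occurrences of a word *)

Lemma occurrences_nil w : occurrences w [::] = (w == [::]).
Proof. by case: w. Qed.

Lemma occurrences_cons w b W :
  occurrences w (b :: W) = prefix w (b :: W) + occurrences w W.
Proof.
rewrite /occurrences.
have -> : iota 0 (size (b :: W)).+1 = 0 :: map (addn 1) (iota 0 (size W).+1).
  by rewrite -iotaDl.
by have /= -> := count_cat (fun i => prefix w (drop i (b :: W))) [:: 0] (map (addn 1) (iota 0 (size W).+1));
  rewrite count_map addn0.
Qed.

(** The successor in the lower bound is due to the empty word, which occurs [(size U).+1] times in
    [U]. The term [size w] bounds the straddling occurrences. *)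
Lemma occurrences_cat w U V :
  occurrences w U + occurrences w V <= (occurrences w (U ++ V)).+1 /\
  occurrences w (U ++ V) <= occurrences w U + occurrences w V + size w.
Proof.
have pc W : prefix w W -> prefix w (W ++ V) by move=> /prefixP[s ->]; rewrite -catA prefix_prefix.
split.
  elim: U => [|b U IH]; first by rewrite occurrences_nil /=; case: (w == _); lia.
  rewrite cat_cons !occurrences_cons; have := pc (b :: U).
  by case: (prefix w (b :: U)) => [/(_ isT) /= ->|_] /=; lia.
(* The minimum lets the induction start at 0 and grows by 1 exactly as long as [w] does not fit into
   [U]. *)
suff : occurrences w (U ++ V) <= occurrences w U + occurrences w V +
    minn (size w) (size U) by lia.
elim: U => [|b U IH]; first by rewrite /=; lia.
rewrite cat_cons !occurrences_cons -cat_cons.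
have [pU|npU] := boolP (prefix w (b :: U)); first by rewrite (pc _ pU) /=; lia.
have [p|_] := boolP (prefix w _); last by rewrite /=; lia.
have : size (b :: U) < size w.
  rewrite ltnNge; apply: contra npU => le; move: p.
  by rewrite !prefixE take_cat; case: ltngtP le => // e _;
    rewrite ?e ?subnn ?take0 ?cats0 // take_size.
by rewrite /=; lia.
Qed.

Lemma occurrences_le w U : occurrences w U <= (size U).+1.
Proof. by apply: leq_trans (count_size _ _) _; rewrite size_iota. Qed.

Lemma occurrences_consl w W : word W ->
  occurrences (1 :: w) W + occurrences (3 :: w) W + prefix w W = occurrences w W.
Proof.
elim: W => [|b W IH]; first by rewrite !occurrences_nil prefixs0.
move=> /andP[lb /IH]; rewrite !occurrences_cons /=.
by case/letterP: lb => ->; lia.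
Qed.

Lemma occurrences_rcons w W : word W ->
  occurrences (rcons w 1) W + occurrences (rcons w 3) W <= occurrences w W /\
  occurrences w W <= (occurrences (rcons w 1) W + occurrences (rcons w 3) W).+1.
Proof.
move=> lW.
have pE U : word U -> (prefix w U : nat) =
    prefix (rcons w 1) U + prefix (rcons w 3) U + (w == U).
  elim: w U {W lW} => [|a w IH] [|b U] //= /andP[lb lU].
    by case/letterP: lb => ->; rewrite ?prefix0s.
  rewrite eqseq_cons; by case: eqVneq => //= _; rewrite (IH _ lU).
(* Only an occurrence at the very end of [W] has no continuation. The correction appears in the
   induction once, when the current suffix equals [w]. *)
have [H1 H2] : occurrences (rcons w 1) W + occurrences (rcons w 3) W <= occurrences w W /\
  occurrences w W <= occurrences (rcons w 1) W + occurrences (rcons w 3) W +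
    (size w <= size W); last by split=> //; case: leqP H2; lia.
elim: W lW => [|b W IH] lW.
  by rewrite !occurrences_nil; case: (w).
have /andP[_ /IH[H1 H2]] := lW.
rewrite !occurrences_cons (pE _ lW).
case: eqVneq => [e|_]; last by move: H1 H2 => /=; case: leqP; case: leqP; lia.
by move: H1 H2; rewrite e /= ltnn leqnn; lia.
Qed.

Lemma occurrences_infix w W : ~~ infix w W -> occurrences w W = 0.
Proof.
elim: W => [|b W IH]; first by rewrite infixs0 occurrences_nil => /negbTE ->.
rewrite infix_consl negb_or => /andP[/negbTE np /IH E].
by rewrite occurrences_cons E np.
Qed.

Lemma flatten_cut_suffix T U (f : T -> seq U) K u a b :
  (forall c, size (f c) <= K) -> flatten (map f u) = a ++ b ->
  exists u1 u2 r, [/\ u = u1 ++ u2, b = r ++ flatten (map f u2) & size r <= K].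
Proof.
move=> fK; elim: u a => [|c u IH] a /=.
  by case: a b => [] // [] // _; exists [::], [::], [::].
have [le E|lt E] := leqP (size a) (size (f c)).
  exists [:: c], u, (drop (size a) (f c)); split=> //.
    have := congr1 (drop (size a)) E; rewrite [RHS]drop_size_cat // drop_cat.
    move: le; rewrite leq_eqVlt => /orP[/eqP e|->] // <-.
    by rewrite e ltnn subnn drop0 drop_size.
  by rewrite size_drop; apply: leq_trans (leq_subr _ _) (fK c).
have := congr1 (drop (size (f c))) E.
rewrite [LHS]drop_size_cat // drop_cat lt => /IH[u1 [u2 [r [-> -> rK]]]].
by exists (c :: u1), u2, r.
Qed.

Lemma flatten_cut_prefix T U (f : T -> seq U) K u a b :
  (forall c, size (f c) <= K) -> flatten (map f u) = a ++ b ->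
  exists u1 u2 r, [/\ u = u1 ++ u2, a = flatten (map f u1) ++ r & size r <= K].
Proof.
move=> fK; elim: u a => [|c u IH] a /=.
  by case: a => // _; exists [::], [::], [::].
have [lt E|le E] := ltnP (size a) (size (f c)).
  by exists [::], (c :: u), a; split => //; apply: leq_trans (ltnW lt) (fK c).
have := congr1 (drop (size (f c))) E.
rewrite [LHS]drop_size_cat // => D.
have : flatten (map f u) = drop (size (f c)) a ++ b.
  rewrite D drop_cat; case: ltngtP le => // e _.
  by rewrite e subnn drop0 drop_size.
move=> /IH[u1 [u2 [r [-> aE rK]]]]; exists (c :: u1), u2, r; split => //=.
rewrite -catA -aE -[LHS](cat_take_drop (size (f c))); congr (_ ++ _).
have := congr1 (take (size (f c))) E.
rewrite [LHS]take_size_cat // take_cat => h; rewrite [RHS]h; case: ltngtP le => // e _.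
by rewrite e subnn take0 cats0 take_size.
Qed.

Definition image (tau : nat -> bool) (n : nat) (c : code) : seq nat :=
  phi (substs tau n [:: c]).

Lemma phi_substs tau n u : phi (substs tau n u) = flatten (map (image tau n) u).
Proof.
elim: u => [|c u IH]; first by rewrite substs_nil.
by rewrite -cat1s substs_cat phi_cat IH.
Qed.

Lemma bounded_code (g : code -> nat) : exists K, forall c, g c <= K.
Proof. by exists (g cA + g cB + g cC + g cD); case; lia. Qed.

(** Incomplete images at both ends are cut off, and one more image if needed to make the number of
    remaining letters even, hence the word balanced. This explains the [3 * K] below, which also
    ensures that a letter remains. *)
Lemma lang_decomp tau n : exists K, forall W, lang tau n W -> K < size W ->
  exists u p q, [/\ balanced u, W = p ++ phi (substs tau n u) ++ q &
    size p + size q <= K].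
Proof.
have [K fK] := bounded_code (fun c => size (image tau n c)).
exists (3 * K) => W [u au /infixP[a [b]]].
rewrite phi_substs => /(flatten_cut_suffix fK)[u1 [u2 [p [uE E pK]]]] WK.
have [r Wr Er] : exists2 r, W = p ++ r & flatten (map (image tau n) u2) = r ++ b.
  have sp : size p < size W by lia.
  exists (drop (size p) W).
    have := congr1 (take (size p)) E; rewrite [RHS]take_size_cat // take_cat sp.
    by move=> e; rewrite -[LHS](cat_take_drop (size p)) e.
  have := congr1 (drop (size p)) E.
  by rewrite [RHS]drop_size_cat // drop_cat sp => <-.
have [u3 [u4 [q [u2E rE qK]]]] := flatten_cut_prefix fK Er.
have [_ /alternating_cat[au3 _]] : alternating u1 /\ alternating (u3 ++ u4).
  by apply: alternating_cat; rewrite -u2E -uE.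
rewrite Wr rE !size_cat in WK *.
have [od|ev] := boolP (odd (size u3)).
  case/lastP: u3 au3 od rE u2E WK => // v c au3 od rE u2E WK.
  rewrite map_rcons flatten_rcons size_cat in WK.
  have cK := fK c.
  exists v, p, (image tau n c ++ q); split.
  - apply: balanced_alternating.
    + by move: au3; rewrite -cats1 => /alternating_cat[].
    + by move: od; rewrite size_rcons.
    + by case: v WK {od au3 rE u2E} => //=; lia.
  - by rewrite phi_substs map_rcons flatten_rcons -!catA.
  - by rewrite size_cat; lia.
exists u3, p, q; split; last by lia.
- by apply: balanced_alternating => //; case: u3 WK {ev au3 rE u2E} => //=; lia.
- by rewrite phi_substs.
Qed.

(** * Existence of the frequencies *)

Section Frequency.
Variable R : realType.
Local Open Scope classical_set_scope.
Local Open Scope ring_scope.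
Implicit Types (w W : seq nat) (v : seq code) (tau : nat -> bool).

Definition freq w W : R := (occurrences w W)%:R / (size W)%:R.

Lemma occurrences_catR w U V :
  `|(occurrences w (U ++ V))%:R - (occurrences w U)%:R - (occurrences w V)%:R|
    <= (size w).+1%:R :> R.
Proof.
have [H1 H2] := occurrences_cat w U V.
rewrite ler_norml; apply/andP; split.
  rewrite -addrA -opprD lerBrDr addrC lerBlDr -!natrD ler_nat.
  by rewrite addnS -addSn; apply: leq_trans H1 _; rewrite addSn ltnS leq_addr.
rewrite -addrA -opprD lerBlDr -!natrD ler_nat.
by apply: leq_trans H2 _; rewrite addSn addnC leqW.
Qed.

Lemma occurrences_flatten w (T : Type) (f : T -> seq nat) u :
  `|(occurrences w (flatten (map f u)))%:R - \sum_(c <- u) (occurrences w (f c))%:R|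
    <= (size w).+1%:R * (size u).+1%:R :> R.
Proof.
elim: u => [|c u IH].
  rewrite big_nil subr0 occurrences_nil mulr1 ger0_norm ?ler0n // ler_nat.
  by case: (w == _).
rewrite big_cons -(natr1 (size (c :: u))) mulrDr mulr1.
set a := (_ (flatten _))%:R; set b := (_ (f c))%:R; set s := \sum_(_ <- _) _.
have := occurrences_catR w (f c) (flatten (map f u)); rewrite -/a -/b.
set d := (occurrences _ _)%:R => H.
have -> : a - (b + s) = (a - b - d) + (d - s) by ring.
by apply: le_trans (ler_normD _ _) _; rewrite addrC lerD.
Qed.

Lemma sum_balanced (G : code -> R) v : balanced v ->
  \sum_(c <- v) G c = (halfsize v)%:R *
    (G cA * (1 - ratC R v) + G cB * (1 - ratD R v) + G cC * ratC R v + G cD * ratD R v).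
Proof.
move=> bv; have [eA eB eC eD] := numE R bv.
transitivity ((num cA v)%:R * G cA + (num cB v)%:R * G cB + (num cC v)%:R * G cC
    + (num cD v)%:R * G cD); last by rewrite eA eB eC eD; ring.
elim: v {bv eA eB eC eD} => [|c v IH]; first by rewrite big_nil !mul0r !addr0.
rewrite big_cons IH -cat1s !num_cat !natrD.
by case: c; rewrite /num /=; ring.
Qed.

Lemma size_balanced v : balanced v -> size v = (halfsize v).*2.
Proof.
case=> _ e; rewrite -addnn {2}e /halfsize; elim: v {e} => //= c v ->.
by rewrite /num; case: c => /=; lia.
Qed.

Lemma leq_size_phi v : (size v <= size (phi v))%N.
Proof.
elim: v => // c v IH; rewrite phi_cons size_cat size_nseq /=.
by have := len_gt0 c; lia.
Qed.

Lemma size_phi_substs tau n v :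
  size (phi (substs tau n v)) = (\sum_(c <- v) size (image tau n c))%N.
Proof. by rewrite phi_substs size_flatten /shape -map_comp sumnE big_map. Qed.

Lemma size_image_gt0 tau n c : (0 < size (image tau n c))%N.
Proof.
apply: leq_trans (leq_size_phi _).
have : (0 < size [:: c])%N by []; elim: n tau [:: c] => //= n IH tau v v0.
have := IH (tau \o succn) v v0; case: (substs _ n v) => // d u _.
by rewrite subst_cons size_cat; case: (tau 0%N) (d) => [] [].
Qed.

(* Ignores the occurrences that straddle the images of two letters. *)
Definition image_freq w tau n v : R :=
  (\sum_(c <- v) (occurrences w (image tau n c))%:R) /
  (\sum_(c <- v) (size (image tau n c))%:R).

(** The error has two sources. Each seam between images of letters affects at most [(size w).+1]
    occurrences, and there are at most (2/3)^n seams per letter of [W]: [v] has 2h letters, its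
    image at least 2h(3/2)^n. The ends [p] and [q] contribute a bounded amount, divided by
    [size W]. *)
Lemma freq_image_freq w tau n v p q K W : settled R v -> (size p + size q <= K)%N ->
  W = p ++ phi (substs tau n v) ++ q ->
  `|freq w W - image_freq w tau n v| <=
    (size w).+1%:R * (2 / 3) ^+ n + (3 * (size w).+1%:R + 3 * K%:R + 2) / (size W)%:R.
Proof.
move=> sv pqK WE; have bv := sv.1.
set k := (size w).+1%:R; rewrite /freq /image_freq.
set G := \sum_(c <- v) _; set L := \sum_(c <- v) _.
have LE : L = (size (phi (substs tau n v)))%:R.
  by rewrite size_phi_substs natr_sum.
have G0 : 0 <= G by apply: sumr_ge0.
(* The empty word occurs once more than there are letters; the factor 2 absorbs this. *)
have GL : G <= 2 * L.
  rewrite /G /L mulr_sumr ler_sum // => c _; rewrite -natrM ler_nat.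
  apply: leq_trans (occurrences_le _ _) _.
  by have := size_image_gt0 tau n c; lia.
have N_E : (size W)%:R = L + (size p + size q)%:R.
  by rewrite WE !size_cat LE -natrD; congr (_%:R); lia.
have e0 : 0 <= (size p + size q)%:R :> R by rewrite ler0n.
have eK : (size p + size q)%:R <= K%:R :> R by rewrite ler_nat.
have h0 : 0 < (halfsize v)%:R :> R by rewrite ltr0n; case: bv.
have hs : (2 / 3) ^+ n * L >= 2 * (halfsize v)%:R.
  have H := halfsize_substs tau n sv.
  have [bs _] := settled_substs tau n sv.
  have : 2 * (halfsize (substs tau n v))%:R <= L.
    rewrite LE -natrM ler_nat mul2n -size_balanced //; exact: leq_size_phi.
  move=> H2; have e : (2 / 3) ^+ n * (3 / 2) ^+ n = 1 :> R.
    by rewrite -exprMn -[RHS](expr1n _ n); congr (_ ^+ _); field.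
  have -> : 2 * (halfsize v)%:R = (2 / 3) ^+ n * (2 * ((3 / 2) ^+ n * (halfsize v)%:R)) :> R.
    by rewrite mulrCA; congr (_ * _); rewrite mulrA e mul1r.
  have z0 : 0 < (2 / 3) ^+ n :> R by rewrite exprn_gt0 //; lra.
  by rewrite ler_pM2l //; lra.
have z0 : 0 < (2 / 3) ^+ n :> R by rewrite exprn_gt0 //; lra.
have L0 : 0 < L.
  by rewrite -(pmulr_rgt0 _ z0); apply: lt_le_trans hs; lra.
set N := (size W)%:R in N_E *; set e := (size p + size q)%:R in N_E e0 eK.
have N0 : 0 < N by rewrite N_E; lra.
have k0 : 0 <= k by rewrite ler0n.
set o := (occurrences w W)%:R.
have oG : `|o - G| <= k * (2 / 3) ^+ n * N + (3 * k + K%:R + 2).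
  have H1 := occurrences_catR w p (phi (substs tau n v) ++ q).
  have H2 := occurrences_catR w (phi (substs tau n v)) q.
  have H3 := occurrences_flatten w (image tau n) v; rewrite -phi_substs in H3.
  have op : (occurrences w p)%:R + (occurrences w q)%:R <= K%:R + 2 :> R.
    rewrite -!natrD ler_nat.
    apply: leq_trans (leq_add (occurrences_le w p) (occurrences_le w q)) _.
    by rewrite addSn addnS addn2 !ltnS.
  move: H1 H2 H3; rewrite -WE -/G -/o -/k -(natr1 (size v)) size_balanced //.
  rewrite -mul2n natrM.
  set a := (occurrences w (_ ++ q))%:R; set b := (occurrences w (phi _))%:R.
  set c := (occurrences w p)%:R in op *; set d := (occurrences w q)%:R in op *.
  have c0 : 0 <= c by rewrite ler0n.
  have d0 : 0 <= d by rewrite ler0n.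
  have kk : k * (2 * (halfsize v)%:R + 1) <= k * (2 / 3) ^+ n * N + k.
    rewrite mulrDr mulr1 lerD2r -mulrA ler_wpM2l //.
    by apply: le_trans hs _; apply: ler_wpM2l; [exact: ltW|rewrite N_E; lra].
  rewrite !ler_norml => /andP[H1 H1'] /andP[H2 H2'] /andP[H3 H3'].
  by apply/andP; split; lra.
(* This separates the error in the count from the error in the length, [N] exceeding [L] by [e]. *)
have -> : o / N - G / L = (o - G) / N - G / L * (e / N).
  clearbody e; move: N0; rewrite N_E => N0; field.
  by rewrite !gt_eqF.
have H : `|(o - G) / N| <= k * (2 / 3) ^+ n + (3 * k + K%:R + 2) / N.
  rewrite normrM normfV (gtr0_norm N0) ler_pdivrMr //.
  by rewrite mulrDl divfK // gt_eqF.
apply: le_trans (ler_normB _ _) _.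
have H' : `|G / L * (e / N)| <= 2 * K%:R / N.
  rewrite ger0_norm; last by rewrite !mulr_ge0 ?invr_ge0 // ltW.
  rewrite mulrA ler_pM2r ?invr_gt0 //.
  by apply: ler_pM => //; [rewrite divr_ge0 // ltW|rewrite ler_pdivrMr].
apply: le_trans (lerD H H') _.
by rewrite -addrA lerD2l -mulrDl ler_pM2r ?invr_gt0 //; lra.
Qed.

(** After division by [halfsize v], numerator and denominator are affine in the letter ratios and
    the denominator is at least 1, so the quotient is Lipschitz. *)
Lemma image_freq_close w tau n : exists2 C : R, 0 <= C &
  forall v v' d, settled R v -> settled R v' -> close d v v' ->
  `|image_freq w tau n v - image_freq w tau n v'| <= C * d.
Proof.
pose G c : R := (occurrences w (image tau n c))%:R.
pose L c : R := (size (image tau n c))%:R.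
have G0 c : 0 <= G c by rewrite ler0n.
have L1 c : 1 <= L c by rewrite ler1n size_image_gt0.
have GL c : G c <= 2 * L c.
  rewrite /G /L -natrM ler_nat; apply: leq_trans (occurrences_le _ _) _.
  by have := size_image_gt0 tau n c; lia.
pose lin (F : code -> R) v :=
  F cA * (1 - ratC R v) + F cB * (1 - ratD R v) + F cC * ratC R v + F cD * ratD R v.
pose S (F : code -> R) := F cA + F cB + F cC + F cD.
have lin_close F v v' d : (forall c, 0 <= F c) -> close d v v' ->
    `|lin F v - lin F v'| <= S F * d.
  move=> F0 [hC hD]; have d0 : 0 <= d by apply: le_trans hC.
  have -> : lin F v - lin F v' = (F cC - F cA) * (ratC R v - ratC R v') +
      (F cD - F cB) * (ratD R v - ratD R v') by rewrite /lin; ring.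
  apply: le_trans (ler_normD _ _) _; rewrite !normrM.
  have -> : S F * d = (F cC + F cA) * d + (F cD + F cB) * d by rewrite /S; ring.
  apply: lerD; apply: ler_pM => //; rewrite ler_norml; apply/andP; split;
    by have := F0 cA; have := F0 cB; have := F0 cC; have := F0 cD; lra.
have key v : settled R v ->
  [/\ image_freq w tau n v = lin G v / lin L v, 0 <= lin G v,
      lin G v <= 2 * lin L v & 1 <= lin L v].
  move=> [bv _]; have [p0 p1 q0 q1] := rat_bounds R bv.
  have h0 : (halfsize v)%:R != 0 :> R by rewrite pnatr_eq0 -lt0n; case: bv.
  have q0' : 0 <= 1 - ratC R v by lra.
  have q1' : 0 <= 1 - ratD R v by lra.
  split.
  - rewrite /image_freq (sum_balanced G) // (sum_balanced L) // -/(lin G v) -/(lin L v).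
    by rewrite -mulf_div divff // mul1r.
  - by rewrite /lin !addr_ge0 // mulr_ge0.
  - have -> : 2 * lin L v = 2 * L cA * (1 - ratC R v) + 2 * L cB * (1 - ratD R v) +
        2 * L cC * ratC R v + 2 * L cD * ratD R v by rewrite /lin; ring.
    by rewrite /lin; do ![apply: lerD]; apply: ler_wpM2r.
  - rewrite /lin; have H F a : 0 <= a -> a <= L F * a by move=> a0; rewrite ler_peMl.
    have := H cA _ q0'; have := H cB _ q1'; have := H cC _ p0; have := H cD _ q0; lra.
exists (S G + 2 * S L).
  by rewrite /S; have := G0 cA; have := G0 cB; have := G0 cC; have := G0 cD;
    have := L1 cA; have := L1 cB; have := L1 cC; have := L1 cD; lra.
move=> v v' d sv sv' cl.
have [-> g0 gl l1] := key v sv; have [-> g0' gl' l1'] := key v' sv'.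
have L0 c : 0 <= L c by apply: le_trans (L1 c).
have hG := lin_close G _ _ _ G0 cl; have hL := lin_close L _ _ _ L0 cl.
move: hG hL g0 gl l1 g0' gl' l1'.
set g := lin G v; set g' := lin G v'; set l := lin L v; set l' := lin L v'.
move=> hG hL g0 gl l1 g0' gl' l1'.
have lp : 0 < l by lra.
have lp' : 0 < l' by lra.
have -> : g / l - g' / l' = ((g - g') - g' / l' * (l - l')) / l.
  by field; rewrite !gt_eqF.
rewrite normrM normfV (gtr0_norm lp) ler_pdivrMr //.
have d0 : 0 <= d by case: cl => h _; apply: le_trans h.
apply: (@le_trans _ _ ((S G + 2 * S L) * d)); last first.
  rewrite ler_peMr // mulr_ge0 //.
  by apply: addr_ge0; rewrite ?mulr_ge0 //; rewrite /S !addr_ge0.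
apply: le_trans (ler_normB _ _) _; rewrite [leRHS]mulrDl; apply: lerD => //.
rewrite normrM -mulrA.
apply: ler_pM => //; rewrite ger0_norm ?divr_ge0 ?ler_pdivrMr //; exact: ltW.
Qed.

Lemma geometric_small (e : R) : 0 < e -> exists n0, forall n, (n0 <= n)%N ->
  (2 / 3) ^+ n <= e.
Proof.
move=> e0; have z1 : `|2 / 3 : R| < 1 by rewrite ger0_norm; lra.
have /cvgrPdist_le/(_ e e0)[n0 _ H] := cvg_expr z1.
exists n0 => n le; have /= := H n le.
by rewrite sub0r normrN ger0_norm // exprn_ge0 //; lra.
Qed.

(** Of the [n + m.+1] levels, [n] make the seams rare, [m] bring the letter ratios together, and the
    innermost one produces a settled word. Each word is within e/3 of its [image_freq] (e/6 from the
    seams, e/6 from the ends), and the two values of [image_freq] are within e/3. *)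
Lemma freq_cauchy tau w (e : R) : 0 < e -> exists n N, forall W W',
  lang tau n W -> lang tau n W' -> (N <= size W)%N -> (N <= size W')%N ->
  `|freq w W - freq w W'| <= e.
Proof.
move=> e0; set k : R := (size w).+1%:R.
have k0 : 0 < k by rewrite ltr0n.
have [n /(_ n (leqnn n)) nE] : exists n0, forall n, (n0 <= n)%N -> (2 / 3) ^+ n <= e / 6 / k.
  by apply: geometric_small; rewrite !divr_gt0.
have [C C0 HC] := image_freq_close w tau n.
(* [C + 1] in place of [C], which may be 0. *)
have [m /(_ m (leqnn m)) mE] : exists n0, forall n, (n0 <= n)%N ->
    (2 / 3) ^+ n <= e / 3 / (C + 1).
  by apply: geometric_small; rewrite !divr_gt0 //; lra.
have [K HK] := lang_decomp tau (n + m.+1).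
pose B : R := 3 * k + 3 * K%:R + 2.
have B0 : 0 < B by rewrite /B; have : 0 <= K%:R :> R by []; lra.
have [N HN] : exists N, (K < N)%N /\ 6 * B / e <= N%:R.
  exists (maxn K.+1 (Num.Def.archi_bound (6 * B / e))); split; first exact: leq_maxl.
  apply: (@le_trans _ _ (Num.Def.archi_bound (6 * B / e))%:R).
    by apply/ltW/archi_boundP; rewrite divr_ge0 // ?mulr_ge0 // ltW.
  by rewrite ler_nat leq_maxr.
have main W : lang tau (n + m.+1) W -> (N <= size W)%N ->
    exists2 v, settled R v & `|freq w W - image_freq w tau n
      (substs (fun j => tau (n + j)%N) m v)| <= e / 3.
  move=> lW le; have [u [p [q [bu WE pq]]]] := HK W lW (leq_trans HN.1 le).
  pose t := tau (n + m)%N.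
  exists (subst t u); first exact: settled_subst.
  rewrite substsD substs_snoc in WE.
  have sv := settled_substs (fun j => tau (n + j)%N) m (settled_subst R t bu).
  have := freq_image_freq w sv pq WE => /le_trans; apply.
  rewrite -/k -/B.
  have h1 : k * (2 / 3) ^+ n <= e / 6 by rewrite mulrC -ler_pdivlMr.
  have sW : 0 < (size W)%:R :> R.
    by rewrite ltr0n; apply: leq_trans le; apply: leq_ltn_trans HN.1.
  have h2 : B / (size W)%:R <= e / 6.
    rewrite ler_pdivrMr //; have : 6 * B / e <= (size W)%:R.
      by apply: le_trans HN.2 _; rewrite ler_nat.
    by rewrite ler_pdivrMr // => h; lra.
  by lra.
exists (n + m.+1)%N, N => W W' lW lW' le le'.
have [v sv Hv] := main W lW le; have [v' sv' Hv'] := main W' lW' le'.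
have H := HC _ _ _ (settled_substs _ m sv) (settled_substs _ m sv')
   (close_substs (fun j => tau (n + j)%N) m sv sv').
have H2 : C * (2 / 3) ^+ m <= e / 3.
  apply: (@le_trans _ _ ((C + 1) * (2 / 3) ^+ m)).
    by apply: ler_wpM2r; [rewrite exprn_ge0 //; lra|lra].
  by rewrite mulrC -ler_pdivlMr //; lra.
move: Hv Hv' (le_trans H H2).
by rewrite !ler_norml => /andP[? ?] /andP[? ?] /andP[? ?]; apply/andP; split; lra.
Qed.

(** [[:: cA; cD]] is a shortest settled word (p = 0, q = 1), so the growth bound applies to it from
    the first substitution on. *)
Definition sample tau n : seq nat := phi (substs tau n [:: cA; cD]).

Lemma lang_sample tau n m : (m <= n)%N -> lang tau m (sample tau n).
Proof. by move=> le; apply: langW le _; exists [:: cA; cD] => //; apply: infix_refl. Qed.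

Lemma size_sample tau N : exists n0, forall n, (n0 <= n)%N -> (N <= size (sample tau n))%N.
Proof.
have e0 : 0 < (N.+1%:R)^-1 :> R by rewrite invr_gt0.
have [n0 H] := geometric_small e0.
exists n0 => n /H {}H.
have s0 : settled R [:: cA; cD].
  split=> //; rewrite /ratC /ratD.
  rewrite -[num cC _]/0%N -[num cD _]/1%N -[halfsize _]/1%N mul0r divr1.
  by lra.
have := halfsize_substs tau n s0; have [bs _] := settled_substs tau n s0.
rewrite mulr1 => H2.
apply: leq_trans (leq_size_phi _); rewrite size_balanced //.
rewrite -(ler_nat R) -addnn natrD; set h := _%:R in H2 *.
have e : (2 / 3) ^+ n * (3 / 2) ^+ n = 1 :> R.
  by rewrite -exprMn -[RHS](expr1n _ n); congr (_ ^+ _); field.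
have z0 : 0 < (3 / 2) ^+ n :> R by rewrite exprn_gt0 //; lra.
have : (2 / 3) ^+ n * (3 / 2) ^+ n <= (N.+1%:R)^-1 * (3 / 2) ^+ n :> R.
  by rewrite ler_wpM2r // ltW.
by rewrite e mulrC ler_pdivlMr // mul1r -natr1; lra.
Qed.

Definition limfreq tau w : R := lim (freq w (sample tau n) @[n --> \oo]).

Lemma limfreqP tau w (e : R) : 0 < e -> exists n N, forall W,
  lang tau n W -> (N <= size W)%N -> `|freq w W - limfreq tau w| <= e.
Proof.
have cv : freq w (sample tau n) @[n --> \oo] --> limfreq tau w.
  apply: cauchy_cvg; apply: cauchy_exP => d d0.
  have [n [N H]] := freq_cauchy tau w (divr_gt0 d0 (ltr0Sn _ 1)).
  have [n0 Hn0] := size_sample tau N.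
  exists (freq w (sample tau (maxn n n0))), (maxn n n0) => // k /= le.
  rewrite /ball /=; apply: le_lt_trans (_ : d / 2 < d); last by lra.
  apply: H; try by apply: lang_sample; lia.
  - by apply: Hn0; lia.
  - by apply: Hn0; lia.
move=> e0; have e2 : 0 < e / 2 by lra.
have [n [N H]] := freq_cauchy tau w e2.
have [n0 Hn0] := size_sample tau N.
have /cvgrPdist_le/(_ _ e2)[n1 _ H1] := cv.
exists n, N => W lW le.
pose k := maxn n (maxn n0 n1).
have h1 := H1 k (_ : (n1 <= k)%N); have {}h1 := h1 ltac:(rewrite /k; lia).
have lk : lang tau n (sample tau k) by apply: lang_sample; rewrite /k; lia.
have sk : (N <= size (sample tau k))%N by apply: Hn0; rewrite /k; lia.
have := H _ _ lW lk le sk; move: h1; rewrite /=.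
by rewrite !ler_norml => /andP[? ?] /andP[? ?]; apply/andP; split; lra.
Qed.

End Frequency.

(** * Cylinders *)

Section Cylinders.
Local Open Scope classical_set_scope.
Local Open Scope ring_scope.

Definition word_at (j : int) (w : seq nat) : set biseq :=
  [set x | fac x j (size w) = w].

(** Two cylinders over windows centred at the origin are nested or disjoint, so together with [set0]
    they are closed under intersection and can determine a measure. *)
Definition centered : set (set biseq) :=
  [set A | exists m w, size w = m.*2 /\ A = word_at (- m%:Z) w].

Lemma open_coord (i : int) (a : nat) : open ([set x : {ptws int -> nat} | x i = a]).
Proof.
have -> : [set x : {ptws int -> nat} | x i = a] = proj i @^-1` [set a] by [].
apply: open_comp; last exact: discrete_open.
by move=> x _; apply: proj_continuous.
Qed.

Lemma open_word_at j w : open (word_at j w : set {ptws int -> nat}).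
Proof.
have -> : word_at j w = \bigcap_(k in `I_(size w)) [set x | x (j + k%:Z) = nth 0%N w k].
  apply/seteqP; split=> x; rewrite /word_at /=.
    by move=> e k /= lt; rewrite -[in RHS]e nth_mkseq.
  move=> H; apply: (@eq_from_nth _ 0%N); rewrite size_fac // => k lt.
  by rewrite nth_mkseq // H.
rewrite bigcap_mkord.
elim/big_ind: _ => //; first exact: openT.
  by move=> A B; exact: openI.
by move=> k _; exact: open_coord.
Qed.

Lemma measurable_word_at j w : measurable (word_at j w).
Proof. by apply: sub_sigma_algebra; exact: open_word_at. Qed.

(** The sets of sequences agreeing with [x] on growing windows generate a filter that converges to
    [x] in each coordinate, hence in the product topology. *)
Lemma open_centered (O : set {ptws int -> nat}) x : open O -> O x ->
  exists m : nat, word_at (- m%:Z) (fac x (- m%:Z) m.*2) `<=` O.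
Proof.
move=> oO Ox.
pose B m := [set z : {ptws int -> nat} | forall i : int, (- m%:Z <= i < m%:Z) -> z i = x i].
pose F := filter_from setT B.
have FF : ProperFilter F.
  apply: filter_from_proper; last by move=> m _; exists x.
  apply: filter_from_filter; first by exists 0%N.
  move=> m n _ _; exists (maxn m n) => // z Bz; split=> i lt; apply: Bz; lia.
have : F --> (x : {ptws int -> nat}).
  apply/cvg_sup => i; apply/cvg_image.
    by rewrite eqEsubset; split => y //; exists (dfwith (x : forall _, nat) i y) => //; rewrite dfwithin.
  move=> A /nbhs_singleton Ax; exists ((fun z => z i) @^-1` A).
    exists `|i|%N.+1 => // z Bz /=; rewrite Bz //; lia.
  apply/seteqP; split => [_ [z Az <-] //|a Aa].
  by exists (dfwith (x : forall _, nat) i a); rewrite /= ?dfwithin.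
move=> /(_ O) []; first exact: open_nbhs_nbhs.
move=> m _ H; exists m => z; rewrite /word_at /= size_fac => e; apply: H => i lt.
have := congr1 (nth 0%N ^~ `|(i + m%:Z)%R|%N) e.
rewrite !nth_mkseq; try lia.
by have -> : - m%:Z + `|(i + m%:Z)%R|%N%:Z = i by lia.
Qed.

Lemma measurable_centered : @measurable _ biseq = <<s centered >>.
Proof.
apply/seteqP; split.
  apply: smallest_sub; first exact: smallest_sigma_algebra.
  (* There are countably many pairs of a radius and a word, so the centred cylinders inside [O] form
     a countable cover of it; other pairs contribute [set0]. *)
  move=> O oO; pose U (mw : nat * seq nat) : set biseq :=
    if pselect (size mw.2 = mw.1.*2 /\ word_at (- mw.1%:Z) mw.2 `<=` O)
    then word_at (- mw.1%:Z) mw.2 else set0.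
  have -> : O = \bigcup_mw U mw.
    apply/seteqP; split=> x.
      move=> /(open_centered oO)[m mO]; exists (m, fac x (- m%:Z) m.*2) => //.
      rewrite /U /=; case: pselect => [h|ne] /=; first by rewrite /word_at /= size_fac.
      by apply: ne; rewrite size_fac.
    by move=> [[m w] _]; rewrite /U /=; case: pselect => //= -[_]; apply.
  apply: (@countable_bigcupT_measurable _ (g_sigma_algebraType centered)) => // -[m w].
  rewrite /U /=; case: pselect => [[e sO]|ne] /=; last exact: measurable0.
  by apply: sub_sigma_algebra; exists m, w.
apply: smallest_sub; first exact: smallest_sigma_algebra.
by move=> _ [m [w [_ ->]]]; exact: measurable_word_at.
Qed.

Lemma setI_closed_centered : setI_closed (centered `|` [set set0]).
Proof.
have cmp m w m' w' : size w = m.*2 -> size w' = m'.*2 -> (m <= m')%N ->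
  (centered `|` [set set0]) (word_at (- m%:Z) w `&` word_at (- m'%:Z) w').
  move=> sw sw' le.
  have sub x : word_at (- m'%:Z) w' x -> fac x (- m%:Z) m.*2 = take m.*2 (drop (m' - m)%N w').
    move=> <-; rewrite sw' (_ : m'.*2 = (m' - m) + (m.*2 + (m' - m)))%N; last by lia.
    rewrite !fac_cat drop_size_cat ?size_fac // take_size_cat ?size_fac //.
    by congr fac; lia.
  have [e|ne] := eqVneq (take m.*2 (drop (m' - m)%N w')) w.
    left; exists m', w'; split => //; apply/seteqP; split=> x; first by case.
    by move=> xw; split => //; rewrite /word_at /= sw sub.
  right; apply/seteqP; split=> // x [xw /sub].
  by move: xw; rewrite /word_at /= sw => -> e; rewrite -e eqxx in ne.
move=> A B [[m [w [sw ->]]]|->] [[m' [w' [sw' ->]]]|->]; rewrite ?set0I ?setI0; try by right.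
have [le|/ltnW le] := leqP m m'; first exact: cmp.
by rewrite setIC; exact: cmp.
Qed.

Lemma probability_eq (R : realType) (mu nu : probability biseq R) :
  (forall m w, size w = m.*2 -> mu (word_at (- m%:Z) w) = nu (word_at (- m%:Z) w)) ->
  forall A, measurable A -> mu A = nu A.
Proof.
move=> H A mA.
have T0 : setT = word_at (- 0%N%:Z) [::] by apply/seteqP; split.
apply: (measure_unique (centered `|` [set set0]) (fun=> setT)) => //.
- rewrite measurable_centered; apply/seteqP; split.
    by apply: sub_smallest2r; [exact: smallest_sigma_algebra|move=> B; left].
  apply: smallest_sub; first exact: smallest_sigma_algebra.
  move=> B [|->]; first exact: sub_sigma_algebra.
  exact: (@measurable0 _ (g_sigma_algebraType centered)).
- exact: setI_closed_centered.
- by move=> _; left; exists 0%N, [::].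
- by rewrite bigcup_const.
- move=> B [[m [w [sw ->]]]|->]; first exact: H.
  by rewrite !measure0.
- by move=> _; apply: le_lt_trans (probability_le1 mu measurableT) _; rewrite ltry.
Qed.

End Cylinders.

(** * The limit frequencies as a consistent family *)

Section Consistency.
Variable R : realType.
Local Open Scope classical_set_scope.
Local Open Scope ring_scope.
Implicit Types (w W : seq nat) (tau : nat -> bool).

Lemma limfreq_has_freq tau (x : nat -> nat) w :
  (forall n N, lang tau n (mkseq x N)) -> has_freq x w (limfreq R tau w).
Proof.
move=> lx; apply/cvgrPdist_le => e e0.
have [n [N H]] := limfreqP tau w e0.
exists N => // k /= le; rewrite distrC.
by have := H _ (lx n k); rewrite /freq size_mkseq; apply.
Qed.

Lemma limfreq_near tau w (e : R) : 0 < e ->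
  \forall n \near \oo, `|freq R w (sample tau n) - limfreq R tau w| <= e.
Proof.
move=> e0; have [n [N H]] := limfreqP tau w e0.
have [n0 Hn0] := size_sample R tau N.
exists (maxn n n0) => // k /= le; apply: H; first by apply: lang_sample; lia.
by apply: Hn0; lia.
Qed.

(** Counting identities hold up to a bounded number of occurrences at the ends of a word; along the
    samples this error vanishes. *)
Lemma limfreq_eq tau w (c : nat -> R) (l K : R) :
  (forall e, 0 < e -> \forall n \near \oo, `|c n - l| <= e) ->
  (\forall n \near \oo, `|freq R w (sample tau n) - c n| <= K / (size (sample tau n))%:R) ->
  limfreq R tau w = l.
Proof.
move=> cl H; apply/eqP; rewrite -subr_eq0 -normr_eq0 eq_le normr_ge0 andbT.
apply/ler_addgt0Pr => e e0; rewrite add0r.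
have e3 : 0 < e / 3 by lra.
have [N HN] : exists N, 0 < N%:R :> R /\ K / (e / 3) <= N%:R.
  exists (Num.Def.archi_bound (`|K| / (e / 3))).+1; split; first exact: ltr0Sn.
  apply: (@le_trans _ _ (`|K| / (e / 3))).
    by rewrite ler_pM2r ?invr_gt0 // ler_norm.
  apply: (@le_trans _ _ (Num.Def.archi_bound (`|K| / (e / 3)))%:R); last by rewrite ler_nat.
  by apply/ltW/archi_boundP; rewrite divr_ge0 // ltW.
have [n0 Hn0] := size_sample R tau N.
near \oo => n.
have h1 : `|c n - l| <= e / 3 by near: n; exact: cl.
have h2 : `|freq R w (sample tau n) - limfreq R tau w| <= e / 3.
  by near: n; exact: limfreq_near.
have h3 : `|freq R w (sample tau n) - c n| <= K / (size (sample tau n))%:R by near: n.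
have le : (N <= size (sample tau n))%N by apply: Hn0; near: n; exists n0.
have h4 : K / (size (sample tau n))%:R <= e / 3.
  have leR : N%:R <= (size (sample tau n))%:R :> R by rewrite ler_nat.
  rewrite ler_pdivrMr; last by apply: lt_le_trans leR; case: HN.
  rewrite mulrC -ler_pdivrMr //; apply: le_trans leR; by case: HN.
move: h1 h2 (le_trans h3 h4).
by rewrite !ler_norml => /andP[? ?] /andP[? ?] /andP[? ?]; apply/andP; split; lra.
Unshelve. all: by end_near. Qed.

Lemma limfreq_nil tau : limfreq R tau [::] = 1.
Proof.
apply: (@limfreq_eq _ _ (fun=> 1) _ 1) => [e e0|].
  by near=> n; rewrite subrr normr0 ltW.
have [n0 Hn0] := size_sample R tau 1.
exists n0 => // n /Hn0 s0.
have -> : freq R [::] (sample tau n) - 1 = 1 / (size (sample tau n))%:R.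
  rewrite /freq; have -> : occurrences [::] (sample tau n) = (size (sample tau n)).+1.
    rewrite /occurrences; under eq_count do rewrite prefix0s.
    by rewrite count_predT size_iota.
  have N0 : (size (sample tau n))%:R != 0 :> R by rewrite pnatr_eq0 -lt0n.
  by rewrite -(natr1 (size _)); field.
by rewrite ger0_norm ?divr_ge0.
Unshelve. all: by end_near. Qed.

Lemma limfreq_ge0 tau w : 0 <= limfreq R tau w.
Proof.
apply/ler_addgt0Pr => e e0; near \oo => n.
have : `|freq R w (sample tau n) - limfreq R tau w| <= e.
  by near: n; exact: limfreq_near.
have : 0 <= freq R w (sample tau n) by rewrite divr_ge0.
by rewrite ler_norml => ? /andP[? ?]; lra.
Unshelve. all: by end_near. Qed.

Lemma limfreq_split tau w w1 w3 :
  (forall W, word W ->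
    (occurrences w1 W + occurrences w3 W <= occurrences w W)%N /\
    (occurrences w W <= (occurrences w1 W + occurrences w3 W).+1)%N) ->
  limfreq R tau w = limfreq R tau w1 + limfreq R tau w3.
Proof.
move=> H; pose c n := freq R w1 (sample tau n) + freq R w3 (sample tau n).
apply: (@limfreq_eq _ _ c _ 1) => [e e0|].
  have e2 : 0 < e / 2 by lra.
  near=> n; rewrite /c.
  have : `|freq R w1 (sample tau n) - limfreq R tau w1| <= e / 2.
    by near: n; exact: limfreq_near.
  have : `|freq R w3 (sample tau n) - limfreq R tau w3| <= e / 2.
    by near: n; exact: limfreq_near.
  by rewrite !ler_norml => /andP[? ?] /andP[? ?]; apply/andP; split; lra.
near=> n; rewrite /c /freq; set W := sample tau n.
have [H1 H2] := H W (all_letter_phi _).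
rewrite -mulrDl -mulrBl normrM [X in _ * X]ger0_norm ?invr_ge0 //.
rewrite ler_wpM2r ?invr_ge0 // -natrD ler_norml; apply/andP; split.
  by rewrite lerBrDr addrC lerBlDr natr1 ler_nat ltnW // ltnS.
by rewrite lerBlDr addrC natr1 ler_nat.
Unshelve. all: by end_near. Qed.

Lemma limfreq_rcons tau w :
  limfreq R tau w = limfreq R tau (rcons w 1%N) + limfreq R tau (rcons w 3%N).
Proof. by apply: limfreq_split => W; exact: occurrences_rcons. Qed.

Lemma limfreq_cons tau w :
  limfreq R tau w = limfreq R tau (1%N :: w) + limfreq R tau (3%N :: w).
Proof.
apply: limfreq_split => W /(occurrences_consl w) <-; split; first exact: leq_addr.
by case: prefix; lia.
Qed.

(** Samples of level at least [n] do not contain [w]. This is what concentrates the measure on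
    [Xtype tau]. *)
Lemma limfreq_lang0 tau n w : ~ lang tau n w -> limfreq R tau w = 0.
Proof.
move=> nw; apply: (@limfreq_eq _ _ (fun=> 0) _ 0) => [e e0|].
  by near=> k; rewrite subrr normr0 ltW.
exists n => // k /= le; rewrite mul0r subr0 /freq occurrences_infix ?mul0r ?normr0 //.
by apply/negP => iw; apply: nw; apply: lang_infix iw _; exact: lang_sample.
Unshelve. all: by end_near. Qed.

End Consistency.

(** * Realization by a probability measure *)

Section Lebesgue01.
Variable R : realType.
Local Open Scope classical_set_scope.
Local Open Scope ring_scope.

(** Defined on the whole line with mass only on [0, 1[, so that the coding maps need no subtype. *)
Definition lebesgue01 : set (measurableTypeR R) -> \bar R :=
  mrestr (@lebesgue_measure R) (measurable_itv `[0, 1[).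

HB.instance Definition _ := Measure.on lebesgue01.

Lemma lebesgue01_setT : lebesgue01 setT = 1%:E.
Proof.
by rewrite /lebesgue01 /mrestr /= setTI lebesgue_measure_itv /= lte_fin ltr01 oppr0 adde0.
Qed.

HB.instance Definition _ := Measure_isProbability.Build _ _ _ lebesgue01 lebesgue01_setT.

End Lebesgue01.

Section Realization.
Variables (R : realType) (f : seq nat -> R).
Local Open Scope classical_set_scope.
Local Open Scope ring_scope.
Hypothesis f_nil : f [::] = 1.
Hypothesis f_ge0 : forall w, 0 <= f w.
Hypothesis f_rcons : forall w, f w = f (rcons w 1%N) + f (rcons w 3%N).
Hypothesis f_cons : forall w, f w = f (1%N :: w) + f (3%N :: w).

Definition extend (k : nat) (w : seq nat) (b : nat) : seq nat :=
  if odd k then b :: w else rcons w b.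

(* The words of length [k] correspond to a partition of [0, 1[ into intervals
   of length [f w]; [locate u k] is the word whose interval contains [u],
   together with the left end of this interval.  Words grow alternately to the
   right and to the left, so as to exhaust the bi-infinite sequence. *)
Fixpoint locate (u : R) (k : nat) : seq nat * R :=
  if k is k'.+1 then
    let: (w, a) := locate u k' in
    if u < a + f (extend k' w 1%N) then (extend k' w 1%N, a)
    else (extend k' w 3%N, a + f (extend k' w 1%N))
  else ([::], 0).

Lemma f_extend k w : f w = f (extend k w 1%N) + f (extend k w 3%N).
Proof. by rewrite /extend; case: odd. Qed.

Lemma locateS u k : locate u k.+1 =
  let: (w, a) := locate u k in
  if u < a + f (extend k w 1%N) then (extend k w 1%N, a)
  else (extend k w 3%N, a + f (extend k w 1%N)).
Proof. by []. Qed.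

Lemma size_extend k w b : size (extend k w b) = (size w).+1.
Proof. by rewrite /extend; case: odd => //; rewrite size_rcons. Qed.

Lemma extend_inj k w b w' b' : extend k w b = extend k w' b' -> w = w' /\ b = b'.
Proof. by rewrite /extend; case: odd => [[-> ->]|/rcons_inj[-> ->]]. Qed.

Lemma word_extend k w b : word (extend k w b) = word w && letter b.
Proof.
by rewrite /word /extend; case: odd; rewrite /= ?all_rcons andbC.
Qed.

Lemma extendP k w : size w = k.+1 -> exists w' b, w = extend k w' b /\ size w' = k.
Proof.
rewrite /extend; case: odd; first by case: w => // b w [sw]; exists w, b.
case/lastP: w => // w b; rewrite size_rcons => -[sw]; by exists w, b.
Qed.

Lemma locate_word u k : word (locate u k).1 /\ size (locate u k).1 = k.
Proof.
elim: k => // k; rewrite locateS; case: (locate u k) => w a /= [lw sw].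
by case: ifP => _ /=; rewrite word_extend size_extend lw sw.
Qed.

(** The interval of a word is split at [a + f (extend k w' 1)], the letter 1 taking the left part.
    Points outside [0, 1[ fall to the extreme words, whence the restriction in the last clause;
    measurability is proved on the whole line. *)
Lemma locateP k w : word w -> size w = k -> exists a,
  [/\ forall u, (locate u k).1 = w -> (locate u k).2 = a,
      measurable [set u : measurableTypeR R | (locate u k).1 = w],
      0 <= a /\ a + f w <= 1 &
      forall u, 0 <= u < 1 -> ((locate u k).1 = w <-> a <= u < a + f w)].
Proof.
elim: k w => [|k IH] w.
  move=> _ /eqP; rewrite size_eq0 => /eqP ->; exists 0; split=> //.
  - by rewrite (_ : [set _ | _] = setT) //; apply/seteqP; split.
  - by rewrite f_nil add0r.
  by move=> u u01; rewrite f_nil add0r.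
move=> + /extendP[w' [b [wE sw]]]; rewrite {w}wE word_extend => /andP[lw lb].
have [a [H1 H2 [a0 a1] H3]] := IH _ lw sw; have fw := f_extend k w'.
have g1 := f_ge0 (extend k w' 1%N); have g3 := f_ge0 (extend k w' 3%N).
have E1 u : (locate u k.+1).1 = extend k w' 1%N <->
    (locate u k).1 = w' /\ u < a + f (extend k w' 1%N).
  rewrite locateS; move: (H1 u); case: (locate u k) => v c /= Hc; split.
    case: ifP => /= [lt|_] /extend_inj[e] // _.
    by rewrite -(Hc e); rewrite e in lt.
  by case=> e; rewrite e (Hc e) => ->.
have E3 u : (locate u k.+1).1 = extend k w' 3%N <->
    (locate u k).1 = w' /\ a + f (extend k w' 1%N) <= u.
  rewrite locateS; move: (H1 u); case: (locate u k) => v c /= Hc; split.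
    case: ifP => /= [_|lt] /extend_inj[e] // _.
    by rewrite -(Hc e); rewrite e in lt; rewrite leNgt lt.
  by case=> e; rewrite e (Hc e) ltNge => ->.
case/letterP: lb => ->.
- exists a; split.
  + move=> u e; have [e' lt] := (E1 u).1 e.
    have h := H1 u e'; move: h lt e'; rewrite locateS; case: (locate u k) => v c /= -> + ->.
    by move=> ->.
  + have -> : [set u : measurableTypeR R | (locate u k.+1).1 = extend k w' 1%N] =
       [set u | (locate u k).1 = w'] `&` `]-oo, a + f (extend k w' 1%N)[.
      by apply/seteqP; split=> u /=; rewrite in_itv /= => /E1.
    by apply: measurableI => //; exact: measurable_itv.
  + by split; lra.
  + move=> u u01; split=> [/E1[/(H3 u u01)/andP[le _] lt]|/andP[le lt]].
      by rewrite le.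
    by apply/E1; split=> //; apply/(H3 u u01); rewrite le /= fw; lra.
- exists (a + f (extend k w' 1%N)); split.
  + move=> u e; have [e' le] := (E3 u).1 e.
    have h := H1 u e'; move: h le e'; rewrite locateS; case: (locate u k) => v c /= -> + ->.
    by rewrite leNgt => /negbTE ->.
  + have -> : [set u : measurableTypeR R | (locate u k.+1).1 = extend k w' 3%N] =
       [set u | (locate u k).1 = w'] `&` `[a + f (extend k w' 1%N), +oo[.
      by apply/seteqP; split=> u /=; rewrite in_itv /= andbT => /E3.
    by apply: measurableI => //; exact: measurable_itv.
  + by split; lra.
  + move=> u u01; split=> [/E3[/(H3 u u01)/andP[_ lt] le]|/andP[le lt]].
      by rewrite le /=; lra.
    by apply/E3; split=> //; apply/(H3 u u01); apply/andP; split; lra.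
Qed.

(** Stage [2m] of [locate] fills the window [-m, m[; coordinate [i] is read with m = |i| + 1, whose
    window contains it. *)
Definition realize (u : measurableTypeR R) : biseq :=
  fun i => nth 0%N (locate u `|i|.+1.*2).1 `|(i + `|i|.+1%:Z)%R|%N.

Lemma realizeE u (m : nat) (i : int) : - m%:Z <= i < m%:Z ->
  realize u i = nth 0%N (locate u m.*2).1 `|(i + m%:Z)%R|%N.
Proof.
move=> lt; rewrite /realize; have le : (`|i|.+1 <= maxn m `|i|.+1)%N by lia.
(* Two stages add one letter on the right, then one on the left, so old letters move by one index
   while the origin of the window moves by one as well. *)
have step m' : - m'%:Z <= i < m'%:Z ->
    nth 0%N (locate u m'.+1.*2).1 `|(i + m'.+1%:Z)%R|%N =
    nth 0%N (locate u m'.*2).1 `|(i + m'%:Z)%R|%N.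
  move=> lt'; rewrite doubleS locateS locateS; have [_] := locate_word u m'.*2.
  case: (locate u m'.*2) => w a /= sw.
  have -> : `|(i + m'.+1%:Z)%R|%N = `|(i + m'%:Z)%R|%N.+1 by lia.
  have lts : (`|(i + m'%:Z)%R| < size w)%N by lia.
  by do 2![case: ifP => _]; rewrite /extend /= odd_double /= nth_rcons lts.
have main m1 m2 : - m1%:Z <= i < m1%:Z -> (m1 <= m2)%N ->
    nth 0%N (locate u m2.*2).1 `|(i + m2%:Z)%R|%N =
    nth 0%N (locate u m1.*2).1 `|(i + m1%:Z)%R|%N.
  move=> lt1 /subnKC <-; elim: (m2 - m1)%N => [|d IH]; first by rewrite addn0.
  by rewrite addnS step // ; lia.
by rewrite -(main _ _ _ le) ?(main _ _ lt (leq_maxl m `|i|.+1)) //; lia.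
Qed.

Lemma fac_realize u m : fac (realize u) (- m%:Z) m.*2 = (locate u m.*2).1.
Proof.
have [_ s] := locate_word u m.*2.
apply: (@eq_from_nth _ 0%N) => [|k]; rewrite size_fac // => lt.
rewrite nth_mkseq // (@realizeE u m); last by lia.
by congr nth; lia.
Qed.

Lemma realize_letter u i : letter (realize u i).
Proof.
rewrite /realize; have [+ s] := locate_word u `|i|.+1.*2.
by move=> /all_nthP; apply; rewrite s; lia.
Qed.

Lemma preimage_realize m w : size w = m.*2 ->
  realize @^-1` (word_at (- m%:Z) w) = [set u | (locate u m.*2).1 = w].
Proof.
by move=> sw; apply/seteqP; split=> u; rewrite /word_at /= sw fac_realize.
Qed.

Lemma measurable_locate k w :
  measurable [set u : measurableTypeR R | (locate u k).1 = w].
Proof.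
have [/andP[lw /eqP sw]|nw] := boolP (word w && (size w == k)).
  by have [a []] := locateP lw sw.
rewrite (_ : [set _ | _] = set0) //; apply/seteqP; split=> // u /= e.
by move: nw; have [] := locate_word u k; rewrite e => -> ->; rewrite eqxx.
Qed.

Lemma measurable_realize : measurable_fun setT realize.
Proof.
apply: (measurability _ measurable_centered) => _ [_ [m [w [sw ->]]] <-].
by rewrite setTI preimage_realize //; exact: measurable_locate.
Qed.

Definition realization : probability biseq R :=
  distribution (@lebesgue01 R) (mfun_Sub (mem_set measurable_realize)).

Lemma realization_centered m w : word w -> size w = m.*2 ->
  realization (word_at (- m%:Z) w) = (f w)%:E.
Proof.
move=> lw sw; rewrite /realization /distribution /pushforward /= preimage_realize //.
have [a [_ _ [a0 a1] H]] := locateP lw sw.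
have I01 u : a <= u < a + f w -> 0 <= u < 1.
  by move=> /andP[? ?]; apply/andP; split; lra.
rewrite /lebesgue01 /mrestr.
have -> : [set u | (locate u m.*2).1 = w] `&` `[0, 1[ = `[a, a + f w[%classic.
  apply/seteqP; split=> u /=; rewrite !in_itv /=; first by case=> e u01; exact: (H u u01).1.
  by move=> au; split; [apply/(H _ (I01 _ au))|exact: I01].
rewrite lebesgue_measure_itv /= lte_fin; case: ltP => h.
  by rewrite -EFinB addrAC subrr add0r.
by congr EFin; have := f_ge0 w; lra.
Qed.

Lemma word_at_consE (x : biseq) (j : int) w : (forall i, letter (x i)) ->
  word_at j w x <-> word_at (j - 1) (1%N :: w) x \/ word_at (j - 1) (3%N :: w) x.
Proof.
move=> lx; rewrite /word_at /= !fac_cons subrK; split.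
  by move=> ->; case/letterP: (lx (j - 1)) => ->; [left|right].
by case=> -[_ ->].
Qed.

Lemma word_at_rconsE (x : biseq) (j : int) w : (forall i, letter (x i)) ->
  word_at j w x <-> word_at j (rcons w 1%N) x \/ word_at j (rcons w 3%N) x.
Proof.
move=> lx; rewrite /word_at /= !size_rcons.
have -> : fac x j (size w).+1 = rcons (fac x j (size w)) (x (j + (size w)%:Z)).
  by rewrite /fac mkseqS.
split; last by case=> /rcons_inj[].
by move=> ->; case/letterP: (lx (j + (size w)%:Z)) => ->; [left|right].
Qed.

Lemma realization_split A B C : measurable A -> measurable B ->
  A `&` B = set0 -> (forall u, C (realize u) <-> A (realize u) \/ B (realize u)) ->
  realization C = (realization A + realization B)%E.
Proof.
move=> mA mB AB H; rewrite /realization /distribution /pushforward /=.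
have -> : realize @^-1` C = realize @^-1` A `|` realize @^-1` B.
  by apply/seteqP; split=> u /=; [move/H|move=> h; apply/H].
rewrite measureU //.
- by rewrite -[X in measurable X]setTI; exact: measurable_realize.
- by rewrite -[X in measurable X]setTI; exact: measurable_realize.
- by rewrite -preimage_setI AB preimage_set0.
Qed.

(** Any window grows to a centred one letter by letter, on the right once its left end is in place
    and on the left before; the values add up by [f_rcons] and [f_cons]. *)
Lemma realization_word_at (j : int) w : word w -> realization (word_at j w) = (f w)%:E.
Proof.
have main d : forall (m : nat) (j : int) w, (m.*2 - size w < d)%N ->
    - m%:Z <= j -> j + (size w)%:Z <= m%:Z -> word w ->
    realization (word_at j w) = (f w)%:E; last first.
  by apply: (main _ (`|j| + size w)%N) (ltnSn _) _ _; lia.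
elim: d => // d IH m {}j {}w lt le1 le2 lw.
have dis (k : int) (v v' : seq nat) : size v = size v' -> v != v' ->
    word_at k v `&` word_at k v' = set0.
  move=> e ne; apply/seteqP; split => // x []; rewrite /word_at /= e => -> e'.
  by rewrite e' eqxx in ne.
have [e|lt1] := eqVneq (size w) m.*2.
  by have -> : j = - m%:Z by [lia]; exact: realization_centered.
have [e|ne] := eqVneq j (- m%:Z).
  rewrite (@realization_split (word_at j (rcons w 1%N)) (word_at j (rcons w 3%N))).
  - rewrite f_rcons EFinD; congr (_ + _)%E; apply: (IH m); rewrite ?size_rcons;
      by [lia|rewrite /word all_rcons; apply/andP].
  - exact: measurable_word_at.
  - exact: measurable_word_at.
  - by apply: dis; rewrite ?size_rcons // eqseq_rcons eqxx.
  - by move=> u; apply: word_at_rconsE => i; exact: realize_letter.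
rewrite (@realization_split (word_at (j - 1) (1%N :: w)) (word_at (j - 1) (3%N :: w))).
- by rewrite f_cons EFinD; congr (_ + _)%E; apply: (IH m) => /=; try lia; exact: lw.
- exact: measurable_word_at.
- exact: measurable_word_at.
- exact: dis.
- by move=> u; apply: word_at_consE => i; exact: realize_letter.
Qed.

Lemma realization_notword (j : int) w : ~~ word w -> realization (word_at j w) = 0%E.
Proof.
move=> nw; rewrite /realization /distribution /pushforward /=.
rewrite (_ : _ @^-1` _ = set0) ?measure0 //; apply/seteqP; split=> // u.
rewrite /word_at /= => e; move/negP: nw; apply; rewrite -e.
by apply/allP => a /mapP[i _ ->]; exact: realize_letter.
Qed.

End Realization.

(** * Unique ergodicity *)

Section UniqueErgodicity.
Variable R : realType.
Local Open Scope classical_set_scope.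
Local Open Scope ring_scope.

(** The cylinders of inadmissible words, enumerated by [nat] through [pickle] so that countable
    unions apply directly. *)
Definition forbidden (tau : nat -> bool) (k : nat) : set biseq :=
  if unpickle k is Some (n, (j, w)) then
    if `[< lang tau n w >] then set0 else word_at j w
  else set0.

Lemma setC_Xtype tau : ~` (Xtype tau : set biseq) = \bigcup_k forbidden tau k.
Proof.
apply/seteqP; split=> x.
  move=> nX; apply: contrapT => nf; apply: nX; apply/XtypeE => n j N.
  apply: contrapT => nl; apply: nf; exists (pickle (n, (j, fac x j N))) => //.
  rewrite /forbidden pickleK; case: asboolP => // _.
  by rewrite /word_at /= size_fac.
move=> [k _]; rewrite /forbidden; case: unpickle => // -[n [j w]].
case: asboolP => // nl e /XtypeE /(_ n j (size w)); rewrite e; exact: nl.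
Qed.

Lemma measurable_forbidden tau k : measurable (forbidden tau k).
Proof.
rewrite /forbidden; case: unpickle => [[n [j w]]|]; last exact: measurable0.
case: asboolP => _; [exact: measurable0|exact: measurable_word_at].
Qed.

Lemma measurable_Xtype tau : measurable (Xtype tau : set biseq).
Proof.
rewrite -[Xtype tau]setCK; apply: measurableC; rewrite setC_Xtype.
by apply: bigcupT_measurable => k; exact: measurable_forbidden.
Qed.

Lemma preimage_shift (j : int) w : Defs.shift @^-1` (word_at j w) = word_at (j + 1) w.
Proof.
apply/seteqP; split=> x; rewrite /word_at /=; congr (_ = w); apply: eq_map => i;
  by rewrite /Defs.shift; congr x; lia.
Qed.

Lemma measurable_shift : measurable_fun setT (Defs.shift : biseq -> biseq).
Proof.
apply: (measurability _ measurable_centered) => _ [_ [m [w [sw ->]]] <-].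
by rewrite setTI preimage_shift; exact: measurable_word_at.
Qed.

(** Full mass holds because every forbidden cylinder is null, and invariance because the measure of
    a cylinder does not depend on its position. *)
Lemma ergodic_measure tau : exists mu : probability biseq R,
  invariant_probability_on (Xtype tau) mu /\
  forall j w, mu (word_at j w) = (if word w then limfreq R tau w else 0)%:E.
Proof.
pose mu := realization (limfreq_nil R tau) (@limfreq_ge0 R tau) (@limfreq_rcons R tau)
  (@limfreq_cons R tau).
have muE j w : mu (word_at j w) = (if word w then limfreq R tau w else 0)%:E.
  case: ifP => [lw|/negbT nw]; first exact: realization_word_at.
  exact: realization_notword.
exists mu; split=> //; split.
  have mX := measurable_Xtype tau.
  have C0 : mu (~` Xtype tau) = 0%E.
    apply: measure_negligible; first exact: measurableC.
    rewrite setC_Xtype; apply: negligible_bigcup => k.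
    apply/negligibleP; first exact: measurable_forbidden.
    rewrite /forbidden; case: unpickle => [[n [j w]]|]; last exact: measure0.
    case: asboolP => [_|nl]; first exact: measure0.
    by rewrite [LHS]muE (limfreq_lang0 _ nl); case: ifP.
  have := probability_setC mu mX; rewrite [X in X = _]C0.
  have : mu (Xtype tau) \is a fin_num by exact: fin_num_measure.
  case: (mu (Xtype tau)) => // r _ /= [] /eqP.
  by rewrite eq_sym subr_eq0 => /eqP <-.
pose nu : probability biseq R := distribution mu (mfun_Sub (mem_set measurable_shift)).
apply: (@probability_eq R nu mu) => m w sw.
have -> : nu (word_at (- m%:Z) w) = mu (word_at (- m%:Z + 1) w).
  by rewrite -preimage_shift.
by rewrite !muE.
Qed.

(** The extra [size w] letters make the first [N] positions see a complete window; the other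
    [(size w).+1] positions are the error. *)
Lemma occurrences_count (x : biseq) w N :
  (count (fun i : nat => fac x i%:Z (size w) == w) (iota 0 N) <=
   occurrences w (fac x 0 (N + size w)) <=
   count (fun i : nat => fac x i%:Z (size w) == w) (iota 0 N) + (size w).+1)%N.
Proof.
set k := count _ _; rewrite /occurrences size_fac -addnS iotaD count_cat.
have -> : count (fun i => prefix w (drop i (fac x 0 (N + size w)))) (iota 0 N) = k.
  apply: eq_in_count => i; rewrite mem_iota add0n /= => lt.
  rewrite (_ : N + size w = i + (size w + (N - i)))%N; last by lia.
  rewrite fac_cat drop_size_cat ?size_fac // fac_cat add0r prefixE.
  by rewrite take_size_cat // size_fac.
rewrite leq_addr leq_add2l; apply: leq_trans (count_size _ _) _.
by rewrite size_iota.
Qed.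

(** Integrating the number of visits to the cylinder in [N] steps gives [N] times its measure by
    invariance, whereas this number is close to [N] times the limit frequency uniformly on
    [Xtype tau]. Uniformity replaces the ergodic theorem. *)
Lemma invariant_word_at tau (nu : probability biseq R) w :
  invariant_probability_on (Xtype tau) nu ->
  nu (word_at 0 w) = (limfreq R tau w)%:E.
Proof.
move=> [nuX nuS]; have mX := measurable_Xtype tau.
have mA (i : nat) : measurable (word_at i%:Z w) by exact: measurable_word_at.
have nuA (i : nat) : nu (word_at i%:Z w) = nu (word_at 0 w).
  elim: i => // i IH; rewrite -IH -(nuS _ (mA i)) preimage_shift.
  by congr (nu (word_at _ w)); lia.
have nuAX (i : nat) : nu (word_at i%:Z w `&` Xtype tau) = nu (word_at i%:Z w).
  have XC0 : nu (~` Xtype tau) = 0%E by rewrite probability_setC // nuX subee.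
  rewrite [RHS](measureDI nu (mA i) mX) [X in (X + _)%E](_ : _ = 0%E) ?add0e //.
  apply/eqP; rewrite eq_le measure_ge0 andbT -XC0 le_measure ?inE //.
  - exact: measurableD.
  - exact: measurableC.
have : nu (word_at 0 w) \is a fin_num by apply: fin_num_measure; exact: (mA 0%N).
case E : (nu (word_at 0 w)) => [r| |] // _; congr EFin.
have r0 : 0 <= r by rewrite -lee_fin -E; exact: measure_ge0.
pose h N (x : biseq) : R := \sum_(i <- iota 0 N) \1_(word_at i%:Z w) x.
have hE N x : h N x = (count (fun i : nat => fac x i%:Z (size w) == w) (iota 0 N))%:R.
  rewrite /h; elim: (iota 0 N) => [|i s IH]; first by rewrite big_nil.
  rewrite big_cons IH /= natrD indicE; congr (_%:R + _).
  by congr nat_of_bool; apply/idP/eqP; rewrite in_setE.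
have hint N : (\int[nu]_(x in Xtype tau) (h N x)%:E = (N%:R * r)%:E)%E.
  under eq_integral do rewrite /h -sumEFin.
  rewrite ge0_integral_sum //.
    transitivity (\sum_(i <- iota 0 N) r%:E)%E.
      apply: eq_bigr => i _; rewrite integral_indic //.
      exact: etrans (nuAX i) (etrans (nuA i) E).
    by rewrite sumEFin big_const_seq count_predT size_iota iter_addr_0 mulr_natl.
  by move=> i; apply/measurable_EFinP; exact: measurable_indic.
have cint (c : R) : (\int[nu]_(x in Xtype tau) (cst c%:E) x = c%:E)%E.
  by rewrite integral_cst // [X in (_ * X)%E]nuX mule1.
have upper (N : nat) (d : R) : (forall x, Xtype tau x -> h N x <= d) -> N%:R * r <= d.
  move=> hd; rewrite -lee_fin -hint -[X in (_ <= X)%E]cint; apply: ge0_le_integral => //.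
  - by move=> x _; rewrite lee_fin hE.
  - by apply/measurable_EFinP; apply: measurable_sum => i; exact: measurable_indic.
have lower (N : nat) (c : R) : (forall x, Xtype tau x -> c <= h N x) -> c <= N%:R * r.
  (* The comparison of integrals is for nonnegative functions; a negative bound is trivial. *)
  move=> hc; have [c0|/ltW c0] := leP 0 c; last by apply: le_trans c0 _; rewrite mulr_ge0.
  rewrite -lee_fin -hint -[X in (X <= _)%E]cint; apply: ge0_le_integral => //.
  by apply/measurable_EFinP; apply: measurable_sum => i; exact: measurable_indic.
move: {mA nuA nuAX E hint cint} upper lower => upper lower.
have l0 := limfreq_ge0 R tau w; set l := limfreq R tau w in l0 *.
apply/eqP; rewrite -subr_eq0 -normr_eq0 eq_le normr_ge0 andbT.
apply/ler_addgt0Pr => e e0; rewrite add0r.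
have e2 : 0 < e / 2 by lra.
have [n [N0 H]] := limfreqP tau w e2.
pose s : R := (size w)%:R; have s0 : 0 <= s by rewrite ler0n.
(* [B] dominates the terms of [bnd] that do not grow with [N]; the choice of [N] makes them at most
   N e/2, the other half of the error coming from the frequency. *)
pose B := s * (l + e / 2) + s + 1.
have B0 : 0 <= B by rewrite !addr_ge0 // mulr_ge0 //; lra.
pose N := (maxn N0 (Num.Def.archi_bound (2 * B / e))).+1.
have BN : 2 * B / e <= N%:R.
  apply: (@le_trans _ _ (Num.Def.archi_bound (2 * B / e))%:R).
    by apply/ltW/archi_boundP; rewrite divr_ge0 ?mulr_ge0 // ltW.
  by rewrite ler_nat /N; lia.
have leN : (N0 <= N + size w)%N by apply: leq_trans (leq_addr _ _); rewrite /N leqW // leq_maxl.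
have N_gt0 : 0 < N%:R :> R by rewrite ltr0n.
have bnd x : Xtype tau x -> (N%:R + s) * (l - e / 2) - s - 1 <= h N x <= (N%:R + s) * (l + e / 2).
  move=> Xx; have := H _ (Xtype_lang Xx n 0 (N + size w)).
  rewrite size_fac => /(_ leN).
  have /andP[k1 k2] := occurrences_count x w N.
  move: k1 k2; rewrite -(ler_nat R) -hE => k1; rewrite -(ler_nat R) natrD -hE => k2.
  rewrite /freq size_fac natrD -/s -/l; move: k1 k2; rewrite -(natr1 (size w)) -/s.
  have Ns : 0 < N%:R + s by lra.
  rewrite ler_norml; set o := (occurrences _ _)%:R => h1 h2 /andP[].
  rewrite lerBrDr lerBlDr ler_pdivrMr // ler_pdivlMr // => h3 h4.
  by apply/andP; split; lra.
have U := upper N _ (fun x Xx => (andP (bnd x Xx)).2).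
have L := lower N _ (fun x Xx => (andP (bnd x Xx)).1).
have Be : B <= N%:R * (e / 2).
  by move: BN; rewrite ler_pdivrMr // => h1; lra.
have se : 0 <= s * (e / 2) by rewrite mulr_ge0 // ltW.
have sl : 0 <= s * l by rewrite mulr_ge0.
rewrite ler_norml; apply/andP; split; rewrite -(ler_pM2l N_gt0).
  by move: U L Be; rewrite /B; lra.
by move: U L Be; rewrite /B; lra.
Qed.

End UniqueErgodicity.

Local Open Scope classical_set_scope.
Local Open Scope ring_scope.

Theorem mainTheorem2 (R : realType) :
  (forall tau : nat -> bool,
    exists mu : probability biseq R,
      [/\ invariant_probability_on (Xtype tau) mu,
          forall nu : probability biseq R,
            invariant_probability_on (Xtype tau) nu ->
            forall A : set biseq, measurable A -> nu A = mu A
        & forall x : int -> nat, Xtype tau x ->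
          forall w : seq nat, word w ->
            has_freq (right_half x) w (fine (mu (cylinder w)))])
  /\
  (forall x : nat -> nat, smooth x ->
   forall w : seq nat, word w ->
     exists l : R, has_freq x w l).
Proof.
split=> [tau|x /smooth_lang[tau lx] w lw]; last first.
  by exists (limfreq R tau w); apply: limfreq_has_freq.
have [mu [muX muE]] := ergodic_measure R tau.
exists mu; split=> //.
  move=> nu nuX; apply: probability_eq => m w sw.
  have to0 (mu' : probability biseq R) : invariant_probability_on (Xtype tau) mu' ->
      mu' (word_at (- m%:Z) w) = mu' (word_at 0 w).
    move=> [_ S]; elim: m {sw} => // m <-.
    rewrite -(S _ (measurable_word_at _ _)) preimage_shift.
    by congr (mu' (word_at _ w)); lia.
  by rewrite !to0 // (invariant_word_at w nuX) (invariant_word_at w muX).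
move=> x Xx w lw.
have -> : cylinder w = word_at 0 w.
  apply/seteqP; split=> z; rewrite /cylinder /word_at /= => e; rewrite -[RHS]e;
    by apply: eq_map => i; rewrite /right_half add0r.
rewrite muE lw /=; apply: limfreq_has_freq => n N.
exact: (Xtype_lang Xx n 0 N).
Qed.
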